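(* Let $G=(V,E)$ be an infinite graph and let $\omega$ be an end of $G$. Then: (i) $\omega$ has infinite cohesion (i.e. $\mathrm{coh}(\omega)=\aleph_1$) if and only if $\mathrm{dom}(\omega)=\infty$; (ii) $\omega$ has unbounded cohesion (i.e. $\mathrm{coh}(\omega)=\aleph_0$) if and only if $\deg(\omega)=\infty$ and $\mathrm{dom}(\omega)<\infty$; (iii) for $k\in\mathbb{N}$, $\omega$ has bounded cohesion $\mathrm{coh}(\omega)=k$ if and only if $\deg(\omega)+\mathrm{dom}(\omega)=k-1$.
   Context: A separation of $G$ is a set $\{A,B\}$ with $A\cup B=V$ such that $G$ has no edge between $A\setminus B$ and $B\setminus A$; its orientations are the ordered pairs $(A,B)$ and $(B,A)$, and its order is $|A\cap B|$. Let $\vec S$ denote the set of all oriented separations $(A,B)$ of $G$ with $A\cap B$ finite, and for $k\in\mathbb{N}$ let $\vec S_k\subseteq\vec S$ be the set of those with $|A\cap B|<k$. Topology on $\vec S$: for every finite $Z\subseteq V$ and every oriented separation $(A_Z,B_Z)$ of $G[Z]$, the set of all $(A,B)\in\vec S$ with $A\cap Z=A_Z$ and $B\cap Z=B_Z$ is a basic open set. A subset of $\vec S_k$ is called closed if it is closed in $\vec S$ (equivalently in the subspace $\vec S_k$). For an end $\omega$ (equivalence class of rays, two rays being equivalent if no finite vertex set separates them), the end tangle is $\tau_\omega=\{(A,B)\in\vec S : \text{every ray of }\omega\text{ has a tail in }B\}$. The cohesion of $\omega$ is $\mathrm{coh}(\omega)=\sup\{\kappa\le\aleph_1 : \tau_\omega\cap\vec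 S_k \text{ is closed in }\vec S\text{ for all } k<\kappa\}$ (here $k$ ranges over natural numbers). The (vertex) degree $\deg(\omega)$ is the largest size of a family of pairwise disjoint rays in $\omega$ (possibly $\infty$). A vertex $v$ dominates $\omega$ if it sends infinitely many paths, disjoint except at $v$, to some (equivalently every) ray of $\omega$; $\mathrm{dom}(\omega)$ is the number of vertices dominating $\omega$ (possibly $\infty$).
   Formalization: In the definition of coh(ω), k ranges over all cardinals k<κ, including ℵ0 (with S_ℵ0 = S), not only natural numbers; with k natural only, coh could never equal ℵ0, and (i), (ii) would fail for the Z×Z grid. *)

(* Defs.v *)
From HB Require Import structures.
From mathcomp Require Import all_boot all_order finmap.
From mathcomp Require Import boolp classical_sets functions cardinality.
From mathcomp Require Import topology.
Set Implicit Arguments.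
Unset Strict Implicit.
Unset Printing Implicit Defensive.
Import Order.TTheory.
Local Open Scope classical_set_scope.

Fact size_display : Order.disp_t.
Proof. exact: Order.Disp tt tt. Qed.

(* Sizes: natural numbers, together with a single value for "infinitely many". *)
Inductive enat : Type := ENat of nat | EInf.

HB.instance Definition _ := gen_eqMixin enat.
HB.instance Definition _ := gen_choiceMixin enat.

Definition enat_le (m n : enat) : bool :=
  match m, n with
  | _, EInf => true
  | EInf, ENat _ => false
  | ENat i, ENat j => (i <= j)%N
  end.

Fact enat_le_refl : reflexive enat_le.
Proof. by case=> //= n. Qed.

Fact enat_le_anti : antisymmetric enat_le.
Proof. by case=> [m|] [n|] //= /anti_leq ->. Qed.

Fact enat_le_trans : transitive enat_le.
Proof. by case=> [m|] [n|] [p|] //=; exact: leq_trans. Qed.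

Fact enat_le_total : total enat_le.
Proof. by case=> [m|] [n|] //=; exact: leq_total. Qed.

HB.instance Definition _ := Order.Le_isPOrder.Build size_display enat
  enat_le_refl enat_le_anti enat_le_trans.
HB.instance Definition _ := Order.POrder_isTotal.Build size_display enat
  enat_le_total.

Definition enat_add (m n : enat) : enat :=
  match m, n with
  | ENat i, ENat j => ENat (i + j)
  | _, _ => EInf
  end.

Definition size_of (T : choiceType) (A : set T) : enat :=
  if pselect (finite_set A) then ENat #|` fset_set A| else EInf.

(* The cardinals up to aleph_1. *)
Inductive cardinal : Type := Fin of nat | Aleph0 | Aleph1.

HB.instance Definition _ := gen_eqMixin cardinal.
HB.instance Definition _ := gen_choiceMixin cardinal.

Definition cardinal_le (k l : cardinal) : bool :=
  match k, l with
  | Fin i, Fin j => (i <= j)%N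
  | Fin _, _ => true
  | Aleph0, Fin _ => false
  | Aleph0, _ => true
  | Aleph1, Aleph1 => true
  | Aleph1, _ => false
  end.

Fact cardinal_le_refl : reflexive cardinal_le.
Proof. by case=> //= n. Qed.

Fact cardinal_le_anti : antisymmetric cardinal_le.
Proof. by case=> [m||] [n||] //= /anti_leq ->. Qed.

Fact cardinal_le_trans : transitive cardinal_le.
Proof. by case=> [m||] [n||] [p||] //=; exact: leq_trans. Qed.

Fact cardinal_le_total : total cardinal_le.
Proof. by case=> [m||] [n||] //=; exact: leq_total. Qed.

HB.instance Definition _ :=
  Order.Le_isPOrder.Build size_display cardinal
    cardinal_le_refl cardinal_le_anti cardinal_le_trans.
HB.instance Definition _ :=
  Order.POrder_isTotal.Build size_display cardinal cardinal_le_total.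

Record graph (V : Type) := Graph {
  adj : rel V;
  adj_sym : symmetric adj;
  adj_irr : irreflexive adj
}.

(* (A, B) is an oriented separation of the induced subgraph G[W]. *)
Definition is_separation (V : Type) (G : graph V) (W A B : set V) : Prop :=
  A `|` B = W /\ forall x y, (A `\` B) x -> (B `\` A) y -> ~~ adj G x y.

Record osep (V : Type) (G : graph V) := OSep {
  sideA : set V;
  sideB : set V;
  sideP : is_separation G setT sideA sideB;
  side_fin : finite_set (sideA `&` sideB)
}.

HB.instance Definition _ (V : Type) (G : graph V) := gen_eqMixin (osep G).
HB.instance Definition _ (V : Type) (G : graph V) := gen_choiceMixin (osep G).

Section Topology.
Variables (V : Type) (G : graph V).

(* An index (Z, (A_Z, B_Z)) names the separations inducing (A_Z, B_Z) on Z. *)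
Definition base_index : set (set V * (set V * set V)) :=
  [set i | finite_set i.1 /\ is_separation G i.1 i.2.1 i.2.2].

Definition base_open (i : set V * (set V * set V)) : set (osep G) :=
  [set s | sideA s `&` i.1 = i.2.1 /\ sideB s `&` i.1 = i.2.2].

Let restr (s : osep G) (Z : set V) := (Z, (sideA s `&` Z, sideB s `&` Z)).

Fact restrP (s : osep G) Z : finite_set Z -> base_index (restr s Z).
Proof.
move=> finZ; split => //=; split.
  by rewrite -setIUl (proj1 (sideP s)) setTI.
move=> x y [[Ax Zx] nBx] [[By Zy] nAy].
apply: (proj2 (sideP s)); split => //.
- by move=> Bx; apply: nBx.
- by move=> Ay; apply: nAy.
Qed.

Fact base_cover : \bigcup_(i in base_index) base_open i = setT.
Proof.
apply/seteqP; split => // s _; exists (restr s set0) => //.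
exact: restrP.
Qed.

Fact base_join i j s : base_index i -> base_index j ->
  base_open i s -> base_open j s ->
  exists k, [/\ base_index k, base_open k s
             & base_open k `<=` base_open i `&` base_open j].
Proof.
case: i j => [Z1 [A1 B1]] [Z2 [A2 B2]] [/= f1 _] [/= f2 _] [/= a1 b1] [/= a2 b2].
exists (restr s (Z1 `|` Z2)); split => //.
  by apply: restrP; rewrite finite_setU.
have cut (X Y Z Z' : set V) : X `&` Z = Y `&` Z -> Z' `<=` Z ->
    X `&` Z' = Y `&` Z'.
  by move=> e /setIidPr <-; rewrite !setIA e.
move=> t [/= a b]; split; split => /=.
- by rewrite -a1; apply: cut a _ => x; left.
- by rewrite -b1; apply: cut b _ => x; left.
- by rewrite -a2; apply: cut a _ => x; right.
- by rewrite -b2; apply: cut b _ => x; right.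
Qed.

HB.instance Definition _ := isBaseTopological.Build (osep G) base_cover base_join.

End Topology.

Definition order_of (V : choiceType) (G : graph V) (s : osep G) : nat :=
  #|` fset_set (sideA s `&` sideB s)|.

(* As orders are finite, [osep_lt G Aleph0] contains all oriented separations. *)
Definition osep_lt (V : choiceType) (G : graph V) (k : cardinal) : set (osep G) :=
  [set s | (Fin (order_of s) < k)%O].
Arguments osep_lt {V} G k.

(* A ray, listed from its first vertex. *)
Record ray (V : Type) (G : graph V) := Ray {
  ray_vtx :> nat -> V;
  ray_inj : injective ray_vtx;
  ray_adj : forall n, adj G (ray_vtx n) (ray_vtx n.+1)
}.

HB.instance Definition _ (V : Type) (G : graph V) := gen_eqMixin (ray G).
HB.instance Definition _ (V : Type) (G : graph V) := gen_choiceMixin (ray G).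

(* x :: p is a path, from x to last x p. *)
Definition is_path (V : choiceType) (G : graph V) (x : V) (p : seq V) : bool :=
  path (adj G) x p && uniq (x :: p).

Definition separates (V : choiceType) (G : graph V) (X A B : set V) : Prop :=
  forall x p, is_path G x p -> A x -> B (last x p) ->
    exists2 v, v \in x :: p & X v.

Definition ray_equiv (V : choiceType) (G : graph V) (R Q : ray G) : Prop :=
  ~ exists X, finite_set X /\ separates G X (range R) (range Q).

Definition is_end (V : choiceType) (G : graph V) (w : set (ray G)) : Prop :=
  exists R, w = [set Q | ray_equiv R Q].

Definition end_tangle (V : choiceType) (G : graph V) (w : set (ray G)) :
    set (osep G) :=
  [set s | forall R : ray G, w R ->
    exists n, forall m, (n <= m)%N -> sideB s (R m)].

Definition coh (V : choiceType) (G : graph V) (w : set (ray G)) : cardinal :=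
  supremum (Fin 0)
    [set kappa | forall k : cardinal, (k < kappa)%O ->
       closed (end_tangle w `&` osep_lt G k)].

Definition family_sizes (V : choiceType) (G : graph V) (w : set (ray G)) :
    set enat :=
  [set size_of F | F in [set F : set (ray G) |
     F `<=` w /\ trivIset F (fun R => range R)]].

(* The largest size, not merely the supremum: it is attained by Halin's theorem
   that arbitrarily many disjoint rays in an end yield infinitely many. So the
   default value of xget is never used when w is an end. *)
Definition deg (V : choiceType) (G : graph V) (w : set (ray G)) : enat :=
  xget (ENat 0) (family_sizes w `&` ubound (family_sizes w)).

(* A path in P is given by its list of vertices other than v. *)
Definition dominates (V : choiceType) (G : graph V) (v : V) (w : set (ray G)) :
    Prop :=
  exists R : ray G, w R /\
  exists P : set (seq V),
    [/\ infinite_set P,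
        forall p, P p -> is_path G v p /\ range R (last v p)
      & trivIset P (fun p => [set` p])].

Definition dom (V : choiceType) (G : graph V) (w : set (ray G)) : enat :=
  size_of [set v | dominates v w].

(* Main.v *)
Require Import Defs.
From mathcomp Require Import all_boot all_order finmap.
From mathcomp Require Import boolp classical_sets functions cardinality topology.
Set Implicit Arguments.
Unset Strict Implicit.
Unset Printing Implicit Defensive.
Local Open Scope classical_set_scope.
Local Open Scope fset_scope.

(* If (A, B) is not in the tangle but some (A', B') in the tangle agrees with it
   on a large enough finite set, then A' `&` B' contains any given finitely many
   dominating vertices and meets any given finitely many rays of the end. Hence
   deg + dom >= k makes the k-th part of the tangle closed, and infinitely many
   dominating vertices make the whole tangle closed.
   Conversely let the set D of dominating vertices be finite. A vertex outside D
   is separated from the end by a finite set, so (V, D), which is not in the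
   tangle, is a limit of elements of the tangle; if the k-th part is closed, some
   finite Z therefore has only separators of size at least k from the end. Take
   successive separators S_0, S_1, ..., each of minimum size among those that
   separate all earlier ones from the end. By Menger's theorem S_n \ D is linked
   completely into S_(n+1) \ D, and the linkages concatenate to at least
   |S_n \ D| disjoint rays, all of which lie in the end since no vertex outside
   D survives behind every S_n. Letting the sizes grow, the same construction
   yields infinitely many rays when every part is closed. *)

(** * Menger's theorem with a finite bound, for an arbitrary relation *)

Section Menger.
Context {V : choiceType}.
Implicit Types (e : rel V) (A B X : {fset V}) (E : seq (V * V)).

(** Quantifying over walks instead of paths makes concatenation free; since a walk contains a path
    with the same ends, the notion is the same. *)
Definition separator e A B X : Prop := forall a p,
  a \in A -> path e a p -> last a p \in B -> has (mem X) (a :: p).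

(** The disjoint paths are indexed by their first vertices: [g a] lists the path from [a] without
    [a] itself. *)
Definition linkage e A B A0 (g : V -> seq V) : Prop :=
  [/\ A0 `<=` A,
      forall a, a \in A0 ->
        [/\ path e a (g a), uniq (a :: g a) & last a (g a) \in B]
    & forall a b v, a \in A0 -> b \in A0 ->
        v \in a :: g a -> v \in b :: g b -> a = b].

Lemma linkage_walks e A B A0 (g : V -> seq V) :
  A0 `<=` A ->
  (forall a, a \in A0 -> path e a (g a) /\ last a (g a) \in B) ->
  (forall a b v, a \in A0 -> b \in A0 ->
        v \in a :: g a -> v \in b :: g b -> a = b) ->
  exists h, linkage e A B A0 h.
Proof.
move=> sA gP gD; exists (fun a => shorten a (g a)); split => //.
  by move=> a /gP[pa la]; case: (shortenP pa) la.
move=> a b v aA bA va vb; apply: (gD a b v) => //.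
  have [pa _] := gP a aA; move: va; case: (shortenP pa) => p' _ _ sp.
  by rewrite !inE => /orP[->//|/sp ->]; rewrite orbT.
have [pb _] := gP b bA; move: vb; case: (shortenP pb) => p' _ _ sp.
by rewrite !inE => /orP[->//|/sp ->]; rewrite orbT.
Qed.

Lemma linkage_mono e e' A B A0 g :
  subrel e e' -> linkage e A B A0 g -> linkage e' A B A0 g.
Proof.
move=> se [sA gP gD]; split => // a /gP[pa ua la]; split => //.
exact: sub_path pa.
Qed.

Lemma first_hit (P : pred V) e a p : path e a p -> has P (a :: p) ->
  exists p1 p2, [/\ p = p1 ++ p2, P (last a p1) & ~~ has P (belast a p1)].
Proof.
elim: p a => [|b p IH] a /=.
  by move=> _; rewrite orbF => Pa; exists [::], [::].
case/andP=> eab pb; have [Pa _|nPa] := boolP (P a).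
  by exists [::], (b :: p).
move=> /(IH _ pb)[p1 [p2 [-> lp bp]]]; exists (b :: p1), p2; split => //=.
by rewrite negb_or nPa.
Qed.

Lemma last_hit (P : pred V) a p : has P (a :: p) ->
  exists p1 p2, [/\ p = p1 ++ p2, P (last a p1) & ~~ has P p2].
Proof.
elim: p a => [|b p IH] a.
  by rewrite /= orbF => Pa; exists [::], [::].
have [h _|nh] := boolP (has P (b :: p)).
  have [p1 [p2 [-> lp bp]]] := IH _ h.
  by exists (b :: p1), p2.
rewrite (_ : has P _ = P a || has P (b :: p)) // (negbTE nh) orbF => Pa.
by exists [::], (b :: p).
Qed.

Definition arc E : rel V := fun x y => (x, y) \in E.

Lemma path_arc_notin_src x y E a p :
  path (arc ((x, y) :: E)) a p -> x \notin belast a p -> path (arc E) a p.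
Proof.
elim: p a => //= b p IH a /andP[ab pb]; rewrite inE negb_or => /andP[xa xp].
rewrite IH // andbT; move: ab; rewrite /arc inE => /orP[/eqP[ax _]|//].
by rewrite ax eqxx in xa.
Qed.

Lemma path_arc_notin_tgt x y E a p :
  path (arc ((x, y) :: E)) a p -> y \notin p -> path (arc E) a p.
Proof.
elim: p a => //= b p IH a /andP[ab pb]; rewrite inE negb_or => /andP[xa xp].
rewrite IH // andbT; move: ab; rewrite /arc inE => /orP[/eqP[_ ax]|//].
by rewrite ax eqxx in xa.
Qed.

Lemma mem_cut (a : V) p v : v \in a :: p ->
  exists p1 p2, p = p1 ++ p2 /\ last a p1 = v.
Proof.
rewrite inE => /orP[/eqP->|/splitPr[p1 p2]]; first by exists [::], p.
by exists (rcons p1 v), p2; rewrite cat_rcons last_rcons.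
Qed.

(* Goering's induction on the number of edges. *)
Lemma menger_finite E A B k :
  (forall X, separator (arc E) A B X -> k <= #|` X|) ->
  exists A0 g, linkage (arc E) A B A0 g /\ k <= #|` A0|.
Proof.
elim: E A B => [|[x y] E IH] A B minX.
  exists (A `&` B), (fun=> [::]); split; last first.
    apply: minX => a [|//] aA _ /= aB; by rewrite /= !inE aA aB.
  split; first exact: fsubsetIl.
    by move=> a; rewrite inE => /andP[_ aB].
  by move=> a b v _ _; rewrite !inE => /eqP-> /eqP->.
have sub : subrel (arc E) (arc ((x, y) :: E)).
  by move=> u v; rewrite /arc inE => ->; rewrite orbT.
(* If deleting the arc [(x, y)] leaves no separator with fewer than [k] elements, the induction
   hypothesis applies directly. *)
have [[S sepS ltS]|nS] := pselect (exists2 S : {fset V},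
    separator (arc E) A B S & #|` S| < k); last first.
  have [X sX|A0 [g [lg kA]]] := IH A B.
    by rewrite leqNgt; apply/negP => ltX; apply: nS; exists X.
  by exists A0, g; split => //; exact: linkage_mono lg.
(* Adding either end of the deleted arc to [S] gives a separator for all arcs, so both sets have
   exactly [k] elements. *)
pose P := x |` S; pose Q := y |` S.
have sepP : separator (arc ((x, y) :: E)) A B P.
  move=> a p aA pa lB; have [xp|xp] := boolP (x \in a :: p).
    by apply/hasP; exists x => //; rewrite /= !inE eqxx.
  have /(sepS a p aA)/(_ lB)/hasP[v vp vS] : path (arc E) a p.
    apply: path_arc_notin_src pa _; apply: contra xp; exact: mem_belast.
  by apply/hasP; exists v => //; rewrite /= in vS *; rewrite !inE vS orbT.
have sepQ : separator (arc ((x, y) :: E)) A B Q.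
  move=> a p aA pa lB; have [xp|xp] := boolP (y \in a :: p).
    by apply/hasP; exists y => //; rewrite /= !inE eqxx.
  have /(sepS a p aA)/(_ lB)/hasP[v vp vS] : path (arc E) a p.
    by apply: path_arc_notin_tgt pa _; apply: contra xp; rewrite inE orbC => ->.
  by apply/hasP; exists v => //; rewrite /= in vS *; rewrite !inE vS orbT.
have [xS kP] : x \notin S /\ #|` P| = k.
  have := minX _ sepP; rewrite /P cardfsU1; case: (x \in S) => /=.
    by rewrite add0n leqNgt ltS.
  by rewrite add1n => kS; split => //; apply/eqP; rewrite eqn_leq ltS kS.
have [yS kQ] : y \notin S /\ #|` Q| = k.
  have := minX _ sepQ; rewrite /Q cardfsU1; case: (y \in S) => /=.
    by rewrite add0n leqNgt ltS.
  by rewrite add1n => kS; split => //; apply/eqP; rewrite eqn_leq ltS kS.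
(* Up to its first vertex in [P] a walk cannot leave [x], so it avoids the deleted arc. Hence a set
   separating [A] from [P] without the arc separates [A] from [B]. *)
have [X sX|A0 [g [[sA gP gD] kA]]] := IH A P.
  apply: minX => a p aA pa lB.
  have [p1 [p2 [ep l1 b1]]] := first_hit pa (sepP _ _ aA pa lB).
  move: pa; rewrite ep cat_path => /andP[pa1 _].
  rewrite -cat_cons has_cat; apply/orP; left; apply: sX => //.
  apply: path_arc_notin_src pa1 _; apply: contra b1 => xb.
  by apply/hasP; exists x => //; rewrite /= !inE eqxx.
(* Dually, after its last vertex in [Q] a walk cannot enter [y]. *)
have [X sX|Q0 [h [[sQ hP hD] kQ0]]] := IH Q B.
  apply: minX => a p aA pa lB.
  have [p1 [p2 [ep l1 b1]]] := last_hit (sepQ _ _ aA pa lB).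
  move: pa lB; rewrite ep cat_path last_cat => /andP[_ pa2] lB.
  have /(sX _ _ l1)/(_ lB) hX : path (arc E) (last a p1) p2.
    apply: path_arc_notin_tgt pa2 _; apply: contra b1 => xb.
    by apply/hasP; exists y => //; rewrite /= !inE eqxx.
  case/hasP: hX => v vp vX; apply/hasP; exists v => //.
  rewrite -cat_cons mem_cat; move: vp; rewrite inE => /orP[/eqP->|->].
    by rewrite mem_last.
  by rewrite orbT.
have {sQ kQ0} eQ : Q0 = Q by apply/eqP; rewrite eqEfcard sQ kQ kQ0.
rewrite {Q0}eQ in hP hD.
(* The paths from [A] use up all of [P] as ends, so each meets [P] only at its end; likewise each
   path from [Q] meets [Q] only at its start. *)
pose ends := (fun a => last a (g a)) @` A0.
have eP : ends = P.
  apply/eqP; rewrite eqEfcard; apply/andP; split.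
    by apply/fsubsetP => v /imfsetP[a /gP[_ _ lP] ->].
  rewrite kP (leq_trans kA) // card_in_imfset // => a b aA bA ab.
  by apply: (gD a b (last a (g a))) => //; rewrite ?mem_last // [last _ _]ab mem_last.
have gP' a v : a \in A0 -> v \in a :: g a -> v \in P -> v = last a (g a).
  move=> aA va; rewrite -eP => /imfsetP[b /= bA ev].
  by rewrite (gD a b v) // ev mem_last.
have hQ q v : q \in Q -> v \in q :: h q -> v \in Q -> v = q.
  move=> qQ vq vQ; apply: (hD v q v) => //; by rewrite inE eqxx.
(* The arc continues a path that ends at [x]; a path that ends in [S] continues from the same
   vertex. *)
pose f p := if p == x then y else p.
have fQ p : p \in P -> f p \in Q.
  by rewrite /f !inE; case: (p == x) => /= [_|->]; rewrite ?eqxx ?orbT.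
have fI p q : p \in P -> q \in P -> f p = f q -> p = q.
  rewrite /f !inE; case: (eqVneq p x) => [->|_] /=; case: (eqVneq q x) => [->|_] //= pS qS e.
    by rewrite e qS in yS.
  by rewrite -e pS in yS.
(* Switching paths at a common vertex [v] gives a walk from [A] to [B] without the arc, which must
   meet [S]. It can do so only at [v], which is then both the end of the first path and the start of
   the second. *)
have cross a p v : a \in A0 -> p \in P -> v \in a :: g a -> v \in f p :: h (f p) ->
    last a (g a) = p.
  move=> aA pP va vp.
  have [pa ua lP] := gP a aA; have [ph uh lB] := hP _ (fQ _ pP).
  have [g1 [g2 [eg l1]]] := mem_cut va.
  have [h1 [h2 [eh l2]]] := mem_cut vp.
  have : has (mem S) (a :: g1 ++ h2).
    apply: sepS; first exact: (fsubsetP sA).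
      move: pa ph; rewrite eg eh !cat_path => /andP[-> _] /andP[_].
      by rewrite l1 l2.
    by rewrite last_cat l1 -l2 -last_cat -eh.
  case/hasP => s; rewrite -cat_cons mem_cat => /orP[sg|sh] /= sS.
    have sl : s = last a (g a).
      by apply: gP' => //; rewrite ?eg -?cat_cons ?mem_cat ?sg // !inE sS orbT.
    have sv : s = v.
      rewrite sl eg last_cat -l1.
      move: ua; rewrite eg -cat_cons cat_uniq => /and3P[_ /hasPn nh _].
      case: g2 eg nh => //= b g2 eg nh.
      have := nh (last b g2) (mem_last _ _).
      by move: sl sg; rewrite eg last_cat /= => -> ->.
    have vf : v = f p by apply: hQ => //; rewrite ?fQ // -sv !inE sS orbT.
    rewrite -sl sv vf /f; case: eqP => // px; move: vf.
    by rewrite -sv /f px eqxx => sy; rewrite -sy sS in yS.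
  have shp : s \in f p :: h (f p).
    by rewrite eh !inE mem_cat sh !orbT.
  have sf : s = f p by apply: hQ => //; rewrite ?fQ // !inE sS orbT.
  move: uh; rewrite eh /= mem_cat negb_or -sf sh andbF.
  by [].
pose g' a := g a ++ (if last a (g a) == x then [:: y] else [::])
  ++ h (f (last a (g a))).
have g'P a v : v \in a :: g' a -> (v \in a :: g a) ||
    (v \in f (last a (g a)) :: h (f (last a (g a)))).
  rewrite /g' -cat_cons mem_cat => /orP[->//|]; rewrite mem_cat => /orP[|vh].
    by rewrite /f; case: eqP => //; rewrite !inE => _ ->; rewrite orbT.
  by rewrite !inE vh !orbT.
have [|| g'' lg] := @linkage_walks (arc ((x, y) :: E)) A B A0 g' sA.
- move=> a aA; have [pa ua lP] := gP a aA; have [ph uh lB] := hP _ (fQ _ lP).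
  rewrite /g' cat_path (sub_path sub pa) last_cat /= cat_path last_cat.
  rewrite /f in ph lB *; case: eqP ph lB => [-> ph lB|_ ph lB] /=.
    by rewrite /arc inE eqxx /= (sub_path sub ph) lB.
  by rewrite (sub_path sub ph) lB.
- move=> a b v aA bA /g'P va /g'P vb.
  have [_ _ lPa] := gP a aA; have [_ _ lPb] := gP b bA.
  have lab : last a (g a) = last b (g b) -> a = b.
    move=> e; apply: (gD a b (last a (g a))) => //; first exact: mem_last.
    by rewrite e mem_last.
  case/orP: va => va; case/orP: vb => vb.
  + exact: (gD a b v).
  + by apply: lab; apply: (cross a _ v).
  + by apply: lab; apply/esym; apply: (cross b _ v).
  + by apply: lab; apply: fI => //; apply: (hD _ _ v) => //; exact: fQ.
by exists A0, g''.
Qed.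

(** The bound is raised by one at a time. To pass from [j] to [j + 1], add for each small set [X] of
    vertices in reach of the current arcs a walk of [e] that avoids [X]. A separator of size at most
    [j] would have to lie within reach, and then its own walk avoids it. *)
Lemma finite_arcs e A B k :
  (forall X, separator e A B X -> k <= #|` X|) ->
  exists E, subrel (arc E) e /\
    forall X, separator (arc E) A B X -> k <= #|` X|.
Proof.
move=> minX.
suff H j : j <= k -> exists E, subrel (arc E) e /\
    forall X, separator (arc E) A B X -> j <= #|` X| by exact: H.
elim: j => [_|j IH jk]; first by exists [::].
have [E [sE minE]] := IH (ltnW jk).
have /choice[F FP] (X : {fset V}) : exists ap : V * seq V, #|` X| < k ->
    [/\ ap.1 \in A, path e ap.1 ap.2, last ap.1 ap.2 \in B
      & ~~ has (mem X) (ap.1 :: ap.2)].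
  (* For large [X] any value will do; [X] is nonempty and supplies a vertex. *)
  have [ltX|geX] := ltnP #|` X| k; last first.
    have /fset0Pn[v _] : X != fset0.
      by rewrite -cardfs_gt0; apply: leq_trans geX; exact: leq_ltn_trans jk.
    by exists (v, [::]).
  apply: contrapT => nex.
  have : separator e A B X.
    move=> a p aA pa lB; apply: contrapT => /negP nh; apply: nex.
    by exists (a, p).
  by move/minX; rewrite leqNgt ltX.
pose W := A `|` [fset x.2 | x in E].
pose E' := E ++ flatten [seq zip ((F X).1 :: (F X).2) (F X).2 |
  X <- enum_fset (fpowerset W) & #|` X| < k].
have path_zip (r : rel V) (a : V) p : path r a p -> forall u v : V, (u, v) \in zip (a :: p) p -> r u v.
  elim: p a => //= b p IHp a /andP[ab pb] u v; rewrite inE => /orP[/eqP[-> ->]//|].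
  exact: IHp.
have zip_path (r : rel V) (a : V) p : (forall u v : V, (u, v) \in zip (a :: p) p -> r u v) -> path r a p.
  elim: p a => //= b p IHp a H; rewrite H ?inE ?eqxx //= IHp // => u v uv.
  by apply: H; rewrite inE uv orbT.
exists E'; split.
  move=> u v; rewrite /arc mem_cat => /orP[/sE//|/flattenP[s /mapP[X]]].
  rewrite mem_filter => /andP[ltX _] -> uv; have [_ pX _ _] := FP X ltX.
  exact: path_zip uv.
move=> X sX; rewrite ltnNge; apply/negP => Xj.
have sXE : separator (arc E) A B X.
  move=> a p aA pa; apply: sX => //; apply: sub_path pa => u v.
  by rewrite /arc mem_cat => ->.
have inW a p : a \in A -> path (arc E) a p -> {subset a :: p <= W}.
  move=> aA; have : a \in W by rewrite inE aA.
  elim: p a {aA} => [|b p IHp] a aW /=; first by move=> _ v; rewrite inE => /eqP->.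
  case/andP=> ab pb v; rewrite inE => /orP[/eqP->//|]; apply: IHp => //.
  by rewrite inE; apply/orP; right; apply/imfsetP; exists (a, b).
have /minE : separator (arc E) A B (X `&` W).
  move=> a p aA pa lB; have /hasP[v vp vX] := sXE a p aA pa lB.
  apply/hasP; exists v => //=; rewrite inE; apply/andP; split => //.
  exact: (inW a p).
move=> jXW; have XW : X `&` W = X.
  by apply/eqP; rewrite eqEfcard fsubsetIl (leq_trans Xj).
have ltX : #|` X| < k by exact: leq_ltn_trans jk.
have [aA pa lB /negP] := FP X ltX; apply; apply: sX => //.
apply: zip_path => u v uv; rewrite /arc mem_cat; apply/orP; right.
apply/flattenP; exists (zip ((F X).1 :: (F X).2) (F X).2) => //.
apply/mapP; exists X => //; rewrite mem_filter ltX /= fpowersetE.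
by rewrite -XW fsubsetIr.
Qed.

Lemma menger e A B k :
  (forall X, separator e A B X -> k <= #|` X|) ->
  exists A0 g, linkage e A B A0 g /\ k <= #|` A0|.
Proof.
move=> /finite_arcs[E [sE /menger_finite[A0 [g [lg kA]]]]].
by exists A0, g; split => //; exact: linkage_mono lg.
Qed.
End Menger.

(** * The component of G - S that holds the end, and its relation to domination *)

Section Regions.
Context {V : choiceType} (G : graph V) (R : ray G).
Implicit Types (S T X Z D : {fset V}) (u v : V).

Definition linked S u v : Prop :=
  exists p, [/\ path (adj G) u p, last u p = v & ~~ has (mem S) (u :: p)].

Lemma linked_refl S u : u \notin S -> linked S u u.
Proof. by move=> uS; exists [::]; split => //=; rewrite orbF. Qed.

Lemma linked_trans S u v x : linked S u v -> linked S v x -> linked S u x.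
Proof.
move=> [p [pp <- hp]] [q [qq <- hq]]; exists (p ++ q); rewrite cat_path pp qq.
rewrite last_cat; split => //; rewrite -cat_cons has_cat negb_or hp /=.
by move: hq => /=; rewrite negb_or => /andP[].
Qed.

Lemma linked_step S u v : adj G u v -> u \notin S -> v \notin S -> linked S u v.
Proof.
move=> uv uS vS; exists [:: v]; split => //=; first by rewrite uv.
by rewrite !negb_or uS vS.
Qed.

Lemma linked_ind S (P : set V) u v : P u ->
  (forall x y, P x -> adj G x y -> y \notin S -> P y) -> linked S u v -> P v.
Proof.
move=> Pu H [p [+ <-]]; elim: p u Pu => //= x p IH u Pu /andP[ux px].
rewrite !negb_or => /and3P[uS xS pS]; apply: IH => //; last by rewrite negb_or xS.
exact: H ux xS.
Qed.

Lemma linked_notin S u v : linked S u v -> u \notin S /\ v \notin S.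
Proof.
move=> [p [_ <- /hasPn hp]]; split; apply: hp; first by rewrite inE eqxx.
exact: mem_last.
Qed.

Lemma linked_sym S u v : linked S u v -> linked S v u.
Proof.
move=> uv; have [uS vS] := linked_notin uv.
suff [] : (linked S u `&` linked S ^~ u)%classic v by [].
apply: linked_ind uv; first by split; exact: linked_refl.
move=> x y [ux xu] xy yS; have [_ xS] := linked_notin ux.
split; first by apply: linked_trans ux _; exact: linked_step.
by apply: linked_trans xu; apply: linked_step => //; rewrite adj_sym.
Qed.

Lemma linked_mono S T u v : S `<=` T -> linked T u v -> linked S u v.
Proof.
move=> /fsubsetP ST [p [pp lp /hasPn hp]]; exists p; split => //.
by apply/hasPn => x /hp /=; apply: contra; exact: ST.
Qed.

Lemma linked_path S u v : linked S u v ->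
  exists p, [/\ is_path G u p, last u p = v & ~~ has (mem S) (u :: p)].
Proof.
move=> [p [pp <- /hasPn hp]]; case: (shortenP pp) => q qq uq qp.
exists q; split; rewrite /is_path ?qq //; apply/hasPn => x; rewrite inE => xq.
by apply: hp; rewrite inE; case/orP: xq => [->//|/qp ->]; rewrite orbT.
Qed.

Lemma ray_escapes (Q : ray G) S :
  exists n, forall m, (n <= m)%N -> Q m \notin S.
Proof.
case: S => s cs; suff [n H] : exists n, forall m, (n <= m)%N -> Q m \notin s.
  by exists n => m nm; apply: H.
elim: s {cs} => [|x s [n IH]]; first by exists 0.
have [[i Qi]|nQ] := pselect (exists i, Q i = x).
  exists (maxn i.+1 n) => m; rewrite geq_max => /andP[im nm].
  rewrite inE negb_or IH // andbT -Qi; apply/eqP => /ray_inj mi.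
  by rewrite mi ltnn in im.
exists n => m nm; rewrite inE negb_or IH // andbT.
by apply/eqP => Qm; apply: nQ; exists m.
Qed.

Lemma linked_ray S n m : (forall i, (n <= i)%N -> R i \notin S) ->
  (n <= m)%N -> linked S (R n) (R m).
Proof.
move=> nS; elim: m => [|m IH].
  by rewrite leqn0 => /eqP e; rewrite e; apply: linked_refl; rewrite -e nS.
rewrite leq_eqVlt => /orP[/eqP e|nm].
  by rewrite e; apply: linked_refl; rewrite -e nS.
apply: linked_trans (IH nm) _; apply: linked_step; [exact: ray_adj|exact: nS|].
exact/nS/leqW.
Qed.

(* The component of G - S that contains a tail of R. *)
Definition region S : set V :=
  [set v | exists n, (forall m, (n <= m)%N -> R m \notin S) /\ linked S v (R n)].

Lemma region_ray S n : (forall m, (n <= m)%N -> R m \notin S) -> region S (R n).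
Proof. by move=> H; exists n; split => //; apply: linked_refl; exact: H. Qed.

Lemma regionP S v n : region S v -> (forall m, (n <= m)%N -> R m \notin S) ->
  linked S (R n) v.
Proof.
move=> [k [kS vk]] nS; apply: linked_sym; apply: linked_trans vk _.
apply: (@linked_trans _ _ (R (maxn k n))).
  by apply: linked_ray => //; exact: leq_maxl.
by apply: linked_sym; apply: linked_ray => //; exact: leq_maxr.
Qed.

Lemma region_notin S v : region S v -> v \notin S.
Proof. by move=> [n [_ /linked_notin[]]]. Qed.

Lemma region_link S u v : region S u -> linked S u v -> region S v.
Proof.
move=> [n [nS un]] uv; exists n; split => //.
by apply: linked_trans un; exact: linked_sym.
Qed.

Lemma region_step S u v : region S u -> adj G u v -> v \notin S -> region S v.
Proof.
move=> Su uv vS; apply: region_link (Su) _; apply: linked_step => //.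
exact: region_notin.
Qed.

Lemma region_mono S T : S `<=` T -> (region T `<=` region S)%classic.
Proof.
move=> ST v [n [nT vn]]; exists n; split; last exact: linked_mono vn.
by move=> m /nT; apply: contra; exact: (fsubsetP ST).
Qed.

(** A vertex of the region is linked to every late enough vertex of [R], so the induction may start
    at one where [P] already holds. *)
Lemma region_ind S (P : set V) : 
  (exists n, forall m, (n <= m)%N -> P (R m)) ->
  (forall x y, region S x -> P x -> adj G x y -> region S y -> P y) ->
  (region S `<=` P)%classic.
Proof.
move=> [n nP] H v Sv; have [k kS] := ray_escapes R S.
have mS m : (maxn k n <= m)%N -> R m \notin S.
  by rewrite geq_max => /andP[/kS].
have [] // : (region S `&` P)%classic v.
apply: linked_ind (regionP Sv mS).
  by split; [exact: region_ray|apply: nP; exact: leq_maxr].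
move=> x y [Sx Px] xy yS; have Sy := region_step Sx xy yS.
by split => //; exact: H Sx Px xy Sy.
Qed.

Definition own_end : set (ray G) := [set Q | ray_equiv R Q].

Lemma own_end_region (Q : ray G) S : own_end Q ->
  exists n, forall m, (n <= m)%N -> region S (Q m).
Proof.
move=> wQ; have [n nS] := ray_escapes R S; have [k kS] := ray_escapes Q S.
(* Deleting the initial segments as well forces a joining path to run from the tail of [R] to the
   tail of [Q] outside [S]. *)
pose X := S `|` ([fset x in map R (iota 0 n)] `|` [fset x in map Q (iota 0 k)]).
suff [x [p [[i _ iR] [j _ jQ] pp hX]]] : exists x p, [/\ range R x,
    range Q (last x p), path (adj G) x p & ~~ has (mem X) (x :: p)].
  have ni : (n <= i)%N.
    rewrite leqNgt; apply: contra hX => ilt /=; rewrite -iR !inE.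
    by rewrite (_ : R i \in map R _) ?orbT // map_f // mem_iota.
  have kj : (k <= j)%N.
    rewrite leqNgt; apply: contra hX => jlt; apply/hasP.
    exists (last x p); first exact: mem_last.
    rewrite /= -jQ !inE.
    by rewrite (_ : Q j \in map Q _) ?orbT // map_f // mem_iota.
  have Sj : region S (Q j).
    apply: (@region_link _ (R i)).
      by apply: region_ray => m im; apply: nS; exact: leq_trans im.
    exists p; rewrite iR jQ; split => //; apply: contra hX.
    by apply: sub_has => v /= vS; rewrite inE vS.
  exists j; elim=> [|m IH]; first by rewrite leqn0 => /eqP <-.
  rewrite leq_eqVlt => /orP[/eqP <-//|jm].
  apply: region_step (IH jm) (ray_adj Q m) _; apply: kS.
  exact: leq_trans kj (leqW jm).
apply: contrapT => nex; apply: wQ; exists [set` X]; split.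
  exact: finite_fset.
move=> x p /andP[pp _] Rx Qp; apply: contrapT => nv; apply: nex.
exists x, p; split => //; apply/hasPn => v vp; apply/negP => vX.
by apply: nv; exists v.
Qed.

(** One vertex of [Q] in each region is enough: it is joined to [R] by a path that avoids the given
    finite set. *)
Lemma own_endI (Q : ray G) :
  (forall S, exists n, region S (Q n)) -> own_end Q.
Proof.
move=> H [X [fX sX]]; have [n [k [kX /linked_sym/linked_path]]] := H (fset_set X).
move=> [p [pp lp /hasPn hp]]; have [||v vp Xv] := sX _ _ pp.
- by exists k.
- by exists n.
- by have /= := hp v vp; rewrite in_fset_set // mem_set.
Qed.

Lemma own_end_self : own_end R.
Proof.
apply: own_endI => S; have [n nS] := ray_escapes R S; exists n.
exact: region_ray.
Qed.

(** By disjointness each vertex of [X] lies on at most one member of [P], so only finitely many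
    members meet [X]. The empty list, which stands for the trivial path, is set aside. *)
Lemma disjoint_paths_avoid (P : set (seq V)) X : infinite_set P ->
  trivIset P (fun p => [set` p]) ->
  exists p, [/\ P p, p != [::] & ~~ has (mem X) p].
Proof.
move=> infP tP; apply: contrapT => nex; apply: infP.
pose f v := xget [::] [set p | P p /\ v \in p].
apply: (@sub_finite_set _ _ ([set [::]] `|` (f @` [set` X])%classic)%classic); last first.
  rewrite finite_setU; split; first exact: finite_set1.
  by apply: finite_image; exact: finite_fset.
move=> p Pp; have [->|p0] := eqVneq p [::]; first by left.
right; have [|/negP/negPn/hasP[v vp vX]] := pselect (~~ has (mem X) p).
  by move=> h; exfalso; apply: nex; exists p.
exists v => //; rewrite /f; case: xgetP => [q _ [Pq vq]|/(_ p)[]//].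
by apply: tP => //; exists v.
Qed.

Lemma dominates_region v S : dominates v own_end -> v \notin S -> region S v.
Proof.
move=> [Q [wQ [P [infP PP tP]]]] vS; have [n nS] := own_end_region S wQ.
have [p [Pp p0 hp]] := disjoint_paths_avoid (S `|` [fset x in map Q (iota 0 n)]) infP tP.
have [/andP[pp _] [j _ jQ]] := PP p Pp.
have lp : last v p \in p by case: p p0 {hp Pp pp jQ} => //= a p _; exact: mem_last.
have nj : (n <= j)%N.
  rewrite leqNgt; apply: contra hp => jn; apply/hasP; exists (last v p) => //.
  by rewrite /= !inE -jQ map_f ?orbT // mem_iota.
apply: region_link (nS _ nj) _; apply: linked_sym; exists p; split => //.
rewrite /= negb_or vS /=; apply: contra hp; apply: sub_has => x /= xS.
by rewrite inE xS.
Qed.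

(** The paths are chosen greedily: each avoids, apart from [v], the union of all earlier ones. *)
Lemma region_dominates v : (forall S, v \notin S -> region S v) ->
  dominates v own_end.
Proof.
move=> H; have /choice[F FP] X : exists p : seq V,
    [/\ is_path G v p, range R (last v p), p != [::] & ~~ has (mem X) p].
  (* Removing [v] from [X] does no harm, since a path from [v] never returns to [v]. *)
  have [|n [nS vn]] := H (X `\ v); first by rewrite !inE eqxx.
  have [m Rm vm] : exists2 m, R m != v & linked (X `\ v) v (R m).
    (* If [v] itself is the vertex of [R], the next vertex is taken, to make the path nonempty. *)
    have [Rv|Rv] := eqVneq (R n) v; last by exists n.
    exists n.+1; last by have := linked_ray nS (leqnSn n); rewrite Rv.
    by rewrite -Rv; apply/eqP => /ray_inj/eqP; rewrite eqn_leq ltnn.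
  have [p [pp lp hp]] := linked_path vm; exists p; split => //.
  - by exists m.
  - by apply: contra Rm => /eqP p0; rewrite -lp p0.
  - move: pp => /andP[_ /= /andP[vp _]]; apply/hasPn => x xp /=.
    have /hasPn/(_ x) := hp; rewrite inE xp orbT => /(_ isT) /=.
    by rewrite !inE negb_and negbK => /orP[/eqP xv|//]; rewrite -xv xp in vp.
exists R; split; first exact: own_end_self.
pose X n := iter n (fun X => X `|` [fset x in F X]) fset0.
have XS n : X n.+1 = X n `|` [fset x in F (X n)] by [].
have sX m n v' : (n < m)%N -> v' \in F (X n) -> v' \in X m.
  elim: m => // m IH; rewrite ltnS leq_eqVlt => /orP[/eqP ->|nm] vF.
    by rewrite XS !inE vF orbT.
  by rewrite XS inE IH.
have FX m n v' : v' \in F (X n) -> v' \in F (X m) -> n = m.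
  wlog nm : m n / (n < m)%N => [hw vn vm|vn vm].
    by have [?|?|//] := ltngtP n m; [exact: hw|apply/esym; exact: hw].
  have [_ _ _ /hasPn/(_ _ vm)] := FP (X m).
  by rewrite /= (sX m n).
exists (range (fun n => F (X n))); split.
- move=> fin; apply: infinite_nat; rewrite -(preimage_range (fun n => F (X n))).
  apply: finite_preimage fin => n m _ _ /= e.
  have [_ _ + _] := FP (X n); case En: (F (X n)) => [//|a p] _.
  by apply: (FX m n a); rewrite -?e En inE eqxx.
- by move=> p [n _ <-]; have [] := FP (X n).
- move=> p q [n _ <-] [m _ <-] [x [/= xn xm]]; by rewrite (FX m n x).
Qed.
End Regions.

(** * Tight and minimum cuts, and the linkage between successive ones *)

Section Cuts.
Context {V : choiceType} (G : graph V) (R : ray G) (D : {fset V}).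
Implicit Types (S T X Z : {fset V}) (u v : V).
Local Notation region := (region R).

(* In G - D the set S \ D avoids Z and separates Z from the end of R. *)
Definition cuts Z S : Prop :=
  D `<=` S /\ forall z, z \in Z -> z \in S \/ region S z -> z \in D.

(** Tightness excludes vertices far from the region, so that outside [D] a later cut lies wholly
    behind an earlier one ([tight_cuts_region]). *)
Definition tight S : Prop :=
  forall s, s \in S -> s \notin D -> exists2 y, region S y & adj G s y.

Lemma cuts_sub Z Z' S : Z `<=` Z' -> cuts Z' S -> cuts Z S.
Proof. by move=> /fsubsetP ZZ [DS H]; split => // z /ZZ; exact: H. Qed.

Definition frontier T : {fset V} :=
  D `|` [fset s in T | `[< exists2 y, region T y & adj G s y >]].

(** A step out of the region of [T] ends in a vertex of [T] with a neighbour in that region, which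
    the frontier retains. *)
Lemma frontier_region T : D `<=` T -> region (frontier T) = region T.
Proof.
move=> DT; have ST : frontier T `<=` T.
  by rewrite fsubUset DT; apply/fsubsetP => x; rewrite !inE => /andP[].
apply/seteqP; split; last exact: region_mono.
apply: (@region_ind _ _ _ _ (region T)).
  have [n nT] := ray_escapes R T; exists n => m nm; apply: region_ray => k mk.
  by apply: nT; exact: leq_trans mk.
move=> x y _ Tx xy /region_notin; rewrite !inE /= negb_or negb_and => /andP[_].
have [yT /= /asboolP nex|yT _] := boolP (y \in T).
  by exfalso; apply: nex; exists x => //; rewrite adj_sym.
exact: (region_step Tx xy yT).
Qed.

Lemma frontier_tight T : D `<=` T -> tight (frontier T).
Proof.
move=> DT s + sD; rewrite !inE /= (negbTE sD) => /andP[_ /asboolP].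
by rewrite frontier_region.
Qed.

(** Each [z] outside [D] fails to dominate, so some finite [F z] without [z] keeps it out of the
    region. The union [T] of these sets with [D] may contain other elements of [Z]; passing to the
    frontier removes them, as a neighbour of [z] in the region of [T] would put [z] into the region
    of [F z]. *)
Lemma cuts_exists Z : (forall v, dominates v (own_end R) -> v \in D) ->
  exists S, cuts Z S.
Proof.
move=> domD; have /choice[F FP] v : exists T, v \notin D ->
    v \notin T /\ ~ region T v.
  have [vD|vD] := boolP (v \in D); first by exists fset0.
  apply: contrapT => nex; move/negP: vD; apply; apply: domD.
  apply: region_dominates => T vT; apply: contrapT => nT; apply: nex.
  by exists T.
pose T := D `|` \bigcup_(z <- Z | z \notin D) F z.
have DT : D `<=` T by exact: fsubsetUl.
have FT z : z \in Z -> z \notin D -> F z `<=` T.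
  by move=> zZ zD; apply: fsubsetU; rewrite bigfcup_sup ?orbT.
exists (frontier T); split; first exact: fsubsetUl.
move=> z zZ zS; apply: contrapT => /negP zD.
have [zF nF] := FP z zD; apply: nF.
case: zS; rewrite ?frontier_region // => zT; last exact: region_mono (FT z zZ zD) _ zT.
move: zT; rewrite !inE /= (negbTE zD) => /andP[_ /asboolP[y Ty zy]].
apply: (@region_step _ _ _ _ y) => //; first exact: region_mono (FT z zZ zD) _ Ty.
by rewrite adj_sym.
Qed.

Lemma min_cut_exists Z : (exists S, cuts Z S) ->
  exists S, [/\ cuts Z S, tight S & forall S', cuts Z S' -> #|` S| <= #|` S'|].
Proof.
move=> [S0 cS0].
have exk : exists k, `[< exists2 S, cuts Z S & #|` S| = k >].
  by exists #|` S0|; apply/asboolP; exists S0.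
case: (ex_minnP exk) => k /asboolP[S [DS cS] <-] mS.
exists (frontier S); split.
- split; first exact: fsubsetUl.
  move=> z zZ; rewrite frontier_region //; case=> [|zS]; last by apply: cS; [|right].
  rewrite !inE => /orP[//|/andP[zS _]]; apply: cS => //; by left.
- exact: frontier_tight.
- move=> S' cS'; apply: leq_trans (mS _ _); last by apply/asboolP; exists S'.
  apply: fsubset_leq_card; rewrite fsubUset DS.
  by apply/fsubsetP => x; rewrite !inE => /andP[].
Qed.

Lemma cuts_region_sub S T : D `<=` T -> cuts S T ->
  (region T `<=` region S)%classic.
Proof.
move=> DT [_ ST]; apply: (@region_ind _ _ _ _ (region S)).
  have [n nS] := ray_escapes R S; exists n => m nm; apply: region_ray => k mk.
  by apply: nS; exact: leq_trans mk.
move=> x y _ Sx xy Ty; apply: region_step Sx xy _.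
apply/negP => yS; have /(fsubsetP DT) : y \in D by apply: ST => //; right.
by apply/negP; exact: region_notin Ty.
Qed.

Lemma tight_cuts_region S T t : D `<=` T -> cuts S T -> tight T ->
  t \in T -> t \notin D -> region S t.
Proof.
move=> DT cT tT tT' tD; have [y Ty ty] := tT t tT' tD.
apply: (@region_step _ _ _ _ y); last 2 first.
- by rewrite adj_sym.
- by apply: contra tD => tS; apply: (proj2 cT) => //; left.
exact: cuts_region_sub Ty.
Qed.

(** Menger's theorem is applied between [S] and [T] outside [D]. A set [X] that separates them in
    the part of the graph between the cuts yields, together with [D], a cut of [Z], so minimality of
    [S] bounds its size from below. *)
Lemma min_cut_linkage Z S T :
  cuts Z S -> (forall S', cuts Z S' -> #|` S| <= #|` S'|) ->
  cuts (Z `|` S) T -> tight T ->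
  exists g : V -> seq V,
  (forall s, s \in S -> s \notin D ->
    [/\ path (adj G) s (g s), uniq (s :: g s),
        last s (g s) \in T /\ last s (g s) \notin D,
        forall v, v \in g s -> [/\ region S v, ~ region T v & v \notin D]
      & forall v, v \in belast s (g s) -> v \notin T]) /\
  forall s s' v, s \in S -> s \notin D -> s' \in S -> s' \notin D ->
    v \in s :: g s -> v \in s' :: g s' -> s = s'.
Proof.
move=> [DS cS] minS [DT cT] tT.
have cST : cuts S T by apply: (@cuts_sub _ (Z `|` S)) => //; exact: fsubsetUr.
(* A step of [e] never starts in [T] and never ends in [S], so a walk leaves [S] for good and stops
   on reaching [T]. *)
pose src x := [&& `[< x \in S \/ region S x >], x \notin D, x \notin T
  & `[< ~ region T x >]].
pose tgt y := [&& `[< region S y >], y \notin D & `[< ~ region T y >]].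
pose e : rel V := fun x y => [&& adj G x y, src x & tgt y].
have e_adj : subrel e (adj G) by move=> x y /and3P[].
have e_tgt s p : path e s p -> all tgt p.
  by elim: p s => //= y p IH s /andP[/and3P[_ _ ->] /IH].
have e_src s p : path e s p -> all src (belast s p).
  by elim: p s => //= y p IH s /andP[/and3P[_ -> _] /IH].
have [X sepX|A0 [g [[sA gP gD] kA]]] := @menger _ e (S `\` D) (T `\` D) #|` S `\` D|.
  (* With the rest of [X] dropped, an element of [Z] in the new cut lies in [S] or its region, hence
     in [D]. *)
  pose X' := [fset x in X | `[< x \in S \/ region S x >]].
  suff /minS : cuts Z (D `|` X').
    rewrite -(cardfsID D S) (fsetIidPr DS).
    rewrite cardfsU => le1; rewrite -(leq_add2l #|` D|).
    apply: leq_trans le1 _; apply: leq_trans (leq_subr _ _) _.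
    rewrite leq_add2l; apply: fsubset_leq_card.
    by apply/fsubsetP => x; rewrite !inE => /andP[].
  split; first exact: fsubsetUl.
  move=> z zZ [|zX].
    rewrite !inE => /orP[//|/andP[_ /asboolP]]; exact: cS.
  apply: contrapT => /negP zD.
  have nSz : ~ (z \in S \/ region S z).
    by move=> /(cS z zZ); exact/negP.
  (* The next set contains z and is closed under steps that avoid X' and D,
     but misses region T. *)
  pose P v := ~ (v \in S \/ region S v) \/
    exists s p, [/\ s \in S `\` D, path e s p, last s p = v, src v &
      ~~ has (mem X) (s :: p)].
  have [n nT] := ray_escapes R (T `|` (D `|` X')).
  have TR : region T (R n).
    apply: region_ray => m /nT; by rewrite inE negb_or => /andP[].
  have nX m : (n <= m)%N -> R m \notin D `|` X'.
    by move=> /nT; rewrite inE negb_or => /andP[].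
  suff : P (R n).
    case=> [|[s [p [_ _ _ /and4P[_ _ _ /asboolP]]]]] //; apply.
    right; exact: cuts_region_sub TR.
  apply: linked_ind (linked_sym (regionP zX nX)); first by left.
  move=> x y Px xy; rewrite inE negb_or => /andP[yD yX].
  have [ySS|] := pselect (y \in S \/ region S y); last by left.
  have yX0 : y \notin X by apply: contra yX => yX; rewrite !inE yX; apply/asboolP.
  right; case: Px => [nx|[s [p [sSD pp lp srx hp]]]].
    (* From outside [S] and its region one can enter only through [S]. *)
    have yS : y \in S.
      case: ySS => // Sy; exfalso; apply: nx.
      have [xS|xS] := boolP (x \in S); [by left|right].
      by apply: region_step Sy _ xS; rewrite adj_sym.
    exists y, [::]; split => //=; rewrite ?inE ?yD ?orbF //.
    apply/and4P; split => //; first by apply/asboolP.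
    + apply: contra yD => yT; apply: cT; rewrite ?inE ?yS ?orbT //; by left.
    + by apply/asboolP => Ty; move/negP: yD; apply; apply: cT;
        rewrite ?inE ?yS ?orbT //; right.
  have nTy : ~ region T y.
    move=> Ty; move: srx => /and4P[_ _ xT /asboolP]; apply.
    by apply: region_step Ty _ xT; rewrite adj_sym.
  (* On a return to [S] the walk is restarted at [y]. *)
  have [yS|yS] := boolP (y \in S).
    exists y, [::]; split => //=; rewrite ?inE ?yD ?orbF //.
    apply/and4P; split => //; first by apply/asboolP.
    + by apply: contra yD => yT; apply: cT; rewrite ?inE ?yS ?orbT //; left.
    + exact/asboolP.
  have exy : path e s (rcons p y).
    rewrite rcons_path pp lp /e xy srx /=; apply/and3P; split => //.
      by apply/asboolP; case: ySS => // yS'; rewrite yS' in yS.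
    exact/asboolP.
  have hXy : ~~ has (mem X) (s :: rcons p y).
    by rewrite -rcons_cons has_rcons negb_or hp andbT.
  exists s, (rcons p y); split => //; first by rewrite last_rcons.
  apply/and4P; split => //; try exact/asboolP.
  (* With [y] in [T] the walk would be complete and avoid [X]. *)
  apply/negP => yT; move/negP: hXy; apply; apply: sepX => //.
  by rewrite last_rcons inE yD.
have eA : A0 = S `\` D by apply/eqP; rewrite eqEfcard sA kA.
rewrite eA in gP gD; exists g; split.
  move=> s sS sD; have [|pp up] := gP s; first by rewrite inE sD.
  rewrite inE => /andP[lD lT]; split => //; first exact: sub_path pp.
  - by move=> v /(allP (e_tgt _ _ pp))/and3P[/asboolP ? ? /asboolP].
  - by move=> v /(allP (e_src _ _ pp))/and4P[].
by move=> s s' v sS sD sS' sD'; apply: gD; rewrite inE ?sD ?sD'.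
Qed.
End Cuts.

(** * Concatenating the linkages into disjoint rays of the end *)

Section Threads.
Context {V : choiceType} (G : graph V) (R : ray G) (D : {fset V}).
Context (S : nat -> {fset V}) (g : nat -> V -> seq V).
Local Notation region := (region R).
Hypothesis DS : forall n, D `<=` S n.
Hypothesis tightS : forall n, tight R D (S n).
Hypothesis cutsS : forall n, cuts R D (S n) (S n.+1).
Hypothesis gP : forall n s, s \in S n -> s \notin D ->
  [/\ path (adj G) s (g n s), uniq (s :: g n s),
      last s (g n s) \in S n.+1 /\ last s (g n s) \notin D,
      forall v, v \in g n s -> [/\ region (S n) v, ~ region (S n.+1) v & v \notin D]
    & forall v, v \in belast s (g n s) -> v \notin S n.+1].
Hypothesis gD : forall n s s' v, s \in S n -> s \notin D -> s' \in S n ->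
  s' \notin D -> v \in s :: g n s -> v \in s' :: g n s' -> s = s'.
Hypothesis exitD : exists n, (forall m, (n <= m)%N -> R m \notin D) /\
  ~ (R n \in S 0 \/ region (S 0) (R n)).

Let W n v := (v \in S n \/ region (S n) v) /\ v \notin D.

Let WS n v : W n.+1 v -> region (S n) v.
Proof.
by move=> [[vS|vS] vD]; [exact: (tight_cuts_region (DS n.+1) (cutsS n)) vD |
  exact: (cuts_region_sub (DS n.+1) (cutsS n))].
Qed.

Let regionW n v : region (S n) v -> W n v.
Proof.
move=> Sv; split; first by right.
by apply: contra (region_notin Sv); exact: (fsubsetP (DS n)).
Qed.

Let W_anti n m v : (n <= m)%N -> W m v -> W n v.
Proof.
elim: m => [|m IH]; first by rewrite leqn0 => /eqP->.
rewrite leq_eqVlt => /orP[/eqP->//|nm] Wv; apply: IH => //.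
exact/regionW/WS.
Qed.

Let region_anti n m v : (n <= m)%N -> region (S m) v -> region (S n) v.
Proof.
rewrite leq_eqVlt => /orP[/eqP->//|nm] /regionW Wv.
by apply: WS; exact: W_anti Wv.
Qed.

(** The vertices that lie in every [W n] are closed under steps avoiding [D]. If there were one, it
    would be linked outside [D] to the vertex of [R] given by [exitD], which lies outside [W 0]. *)
Let W_escape v : exists n, ~ W n v.
Proof.
apply: contrapT => nex; have aW n : W n v.
  by apply: contrapT => nW; apply: nex; exists n.
have [n [nD nR]] := exitD; apply: nR.
suff /(_ 0)[] : forall m, W m (R n) by [].
have Dv : linked G D v (R n).
  apply: linked_sym; apply: regionP => //.
  apply: (region_mono (DS 0)); exact: WS.
apply: (@linked_ind _ _ D (fun x => forall m, W m x)) Dv => // x y Wx xy yD m.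
split => //; have [yS|yS] := boolP (y \in S m); [by left|right].
exact: (region_step (WS (Wx m.+1)) xy yS).
Qed.

Let W_escape_fset (X : {fset V}) : exists n, forall v, v \in X -> ~ W n v.
Proof.
case: X => X cX; suff [n H] : exists n, forall v, v \in X -> ~ W n v.
  by exists n => m nm; apply: H.
elim: X {cX} => [|x X [n IH]]; first by exists 0.
have [k nk] := W_escape x; exists (maxn n k) => v.
rewrite inE => /orP[/eqP-> |vX] Wv; first by apply: nk; exact: W_anti (leq_maxr n k) Wv.
by apply: (IH v vX); exact: W_anti (leq_maxl n k) Wv.
Qed.

Let step v u := exists n s i, [/\ s \in S n, s \notin D, (i < size (g n s))%N,
  v = nth s (s :: g n s) i & u = nth s (g n s) i].

(** The level of a step can be read off from either end, but by two different filtrations: the last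
    vertex of a path of level [n] belongs to level [n] as the end of a step and to level [n + 1] as
    the start of one. *)
Let step_level n s i : s \in S n -> s \notin D -> (i < size (g n s))%N ->
  (W n (nth s (s :: g n s) i) /\ ~ W n.+1 (nth s (s :: g n s) i)) /\
  (region (S n) (nth s (g n s) i) /\ ~ region (S n.+1) (nth s (g n s) i)).
Proof.
move=> sS sD ilt; have [pg ug [lS lD] gi gb] := gP sS sD.
have [? ? ?] := gi _ (mem_nth s ilt); split => //.
set v := nth s (s :: g n s) i.
have vb : v \in belast s (g n s).
  rewrite /v (_ : nth _ _ i = nth s (belast s (g n s)) i).
    by rewrite mem_nth // size_belast.
  by rewrite lastI nth_rcons size_belast ilt.
have [Wv nSv] : W n v /\ ~ region (S n.+1) v.
  have := mem_belast vb; rewrite inE => /orP[/eqP ->|/gi[? ? ?]]; last first.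
    by split => //; split=> //; right.
  split; first by split => //; left.
  by move=> sS'; move/negP: sD; apply; apply: (proj2 (cutsS n)) => //; right.
split => //; case=> [[vS|//] _]; by have := gb v vb; rewrite vS.
Qed.

Let level_uniq (A : nat -> V -> Prop) n m v :
  (forall i j x, (i <= j)%N -> A j x -> A i x) ->
  A n v /\ ~ A n.+1 v -> A m v /\ ~ A m.+1 v -> n = m.
Proof.
move=> antiA [An nAn] [Am nAm]; apply/eqP; rewrite eqn_leq.
apply/andP; split; rewrite leqNgt; apply/negP => lt.
  by apply: nAm; apply: antiA An.
by apply: nAn; apply: antiA Am.
Qed.

Let step_fun v u u' : step v u -> step v u' -> u = u'.
Proof.
move=> [n [s [i [sS sD ilt ev ->]]]] [n' [s' [i' [sS' sD' ilt' ev' ->]]]].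
have [lv _] := step_level sS sD ilt; have [lv' _] := step_level sS' sD' ilt'.
rewrite -ev in lv; rewrite -ev' in lv'.
have nn := level_uniq W_anti lv lv'; rewrite -{n'}nn in sS' ilt' ev' lv' *.
have vs : v \in s :: g n s by rewrite ev mem_nth //= ltnW.
have vs' : v \in s' :: g n s' by rewrite ev' mem_nth //= ltnW.
have ss := gD sS sD sS' sD' vs vs'; rewrite -{s'}ss in sS' sD' ilt' ev' vs' *.
have [_ ug _ _ _] := gP sS sD.
suff -> : i = i' by [].
by apply/eqP; rewrite -(nth_uniq s _ _ ug) /= 1?ltnW // -ev ev'.
Qed.

Let step_inj v v' u : step v u -> step v' u -> v = v'.
Proof.
move=> [n [s [i [sS sD ilt -> ev]]]] [n' [s' [i' [sS' sD' ilt' -> ev']]]].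
have [_ lv] := step_level sS sD ilt; have [_ lv'] := step_level sS' sD' ilt'.
rewrite -ev in lv; rewrite -ev' in lv'.
have nn := level_uniq region_anti lv lv'; rewrite -{n'}nn in sS' ilt' ev' lv' *.
have vs : u \in s :: g n s by rewrite ev inE mem_nth ?orbT.
have vs' : u \in s' :: g n s' by rewrite ev' inE mem_nth ?orbT.
have ss := gD sS sD sS' sD' vs vs'; rewrite -{s'}ss in sS' sD' ilt' ev' vs' *.
have [_ /= /andP[_ ug] _ _ _] := gP sS sD.
suff -> : i = i' by [].
by apply/eqP; rewrite -(nth_uniq s _ _ ug) // -ev ev'.
Qed.

Let step_adj v u : step v u -> adj G v u.
Proof.
move=> [n [s [i [sS sD ilt -> ->]]]]; have [pg _ _ _ _] := gP sS sD.
exact: (pathP s pg).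
Qed.

Let g_gt0 n s : s \in S n -> s \notin D -> (0 < size (g n s))%N.
Proof.
move=> sS sD; have [_ _ [lS _] _ _] := gP sS sD.
case: (g n s) lS => //= sS'; exfalso; move/negP: sD; apply.
by apply: (proj2 (cutsS n)) => //; left.
Qed.

Let step_next v u : step v u -> exists u', step u u'.
Proof.
move=> [n [s [i [sS sD ilt _ ->]]]].
have [ilt'|] := ltnP i.+1 (size (g n s)).
  by exists (nth s (g n s) i.+1), n, s, i.+1.
move=> sz; have {ilt sz} ei : i = (size (g n s)).-1.
  by apply/eqP; rewrite eqn_leq -ltnS (prednK (g_gt0 sS sD)) ilt -ltnS
    (prednK (g_gt0 sS sD)) sz.
have [_ _ [lS lD] _ _] := gP sS sD.
rewrite ei nth_last; set t := last _ _ in lS lD *.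
by exists (nth t (g n.+1 t) 0), n.+1, t, 0; split => //; exact: g_gt0.
Qed.

Let live v := exists u, step v u.

Let live_start n s : s \in S n -> s \notin D -> live s.
Proof. by move=> sS sD; exists (nth s (g n s) 0), n, s, 0; split => //; exact: g_gt0. Qed.

Let source v := live v /\ ~ exists u, step u v.

(** There is one ray for each [source]: the successor is defined forever along it, and its
    injectivity makes the rays disjoint. Every vertex of [S n] outside [D] lies on such a ray, and
    no two of them lie on the same one. *)
Lemma threads : exists F : set (ray G),
  [/\ (F `<=` own_end R)%classic, trivIset F (fun Q => range Q)
    & finite_set F -> forall n, #|` S n `\` D| <= #|` fset_set F|].
Proof.
have /choice[f fP] v : exists u, live v -> step v u.
  by have [[u vu]|nv] := pselect (live v); [exists u|exists v].
have f_live v : live v -> live (f v) by move/fP/step_next.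
have iter_live i v : live v -> live (iter i f v).
  by move=> lv; elim: i => //= i /f_live.
have f_inj v v' : live v -> live v' -> f v = f v' -> v = v'.
  by move=> /fP vf /fP vf' e; rewrite -e in vf'; exact: step_inj vf vf'.
have source_inj s s' i j : source s -> source s' ->
    iter i f s = iter j f s' -> i = j /\ s = s'.
  move=> [ls ns] [ls' ns']; elim: i j => [|i IH] [|j] //= e.
  - by exfalso; apply: ns; exists (iter j f s'); rewrite e; exact/fP/iter_live.
  - by exfalso; apply: ns'; exists (iter i f s); rewrite -e; exact/fP/iter_live.
  - by have [|-> ->] := IH j; first by apply: f_inj e; exact: iter_live.
(* After a vertex of [W n] a thread stays strictly behind [S n]; hence it meets [S n] at most once
   outside [D]. *)
have f_region n v i : live v -> W n v -> region (S n) (iter i.+1 f v).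
  move=> lv Wv.
  suff f1 x : live x -> W n x -> region (S n) (f x).
    by elim: i => [|i IH] /=; apply: f1 => //; [exact: (iter_live i.+1)|exact: regionW].
  move=> lx Wx; have [m [s [j [sS sD jlt ev eu]]]] := fP x lx.
  have [[_ nW] [Sf _]] := step_level sS sD jlt.
  rewrite eu; apply: region_anti Sf; rewrite leqNgt; apply/negP => mn.
  by apply: nW; rewrite -ev; exact: W_anti Wx.
have thread n s i : s \in S n -> s \notin D -> (i <= size (g n s))%N ->
    iter i f s = nth s (s :: g n s) i.
  move=> sS sD; elim: i => [//|i IH] ilt; rewrite iterS (IH (ltnW ilt)) /=.
  have st : step (nth s (s :: g n s) i) (nth s (g n s) i) by exists n, s, i.
  have lst : live (nth s (s :: g n s) i) by exists (nth s (g n s) i).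
  exact: (step_fun (fP _ lst) st).
have reach n s m : s \in S n -> s \notin D -> (n <= m)%N ->
    exists i, iter i f s \in S m /\ iter i f s \notin D.
  move=> sS sD; elim: m => [|m IH].
    by rewrite leqn0 => /eqP <-; exists 0.
  rewrite leq_eqVlt => /orP[/eqP <-|]; first by exists 0.
  rewrite ltnS => /IH[i []]; set t := iter i f s => tS tD.
  have [_ _ lS _ _] := gP tS tD; exists (size (g m t) + i)%N.
  by rewrite iterD -/t (thread m) //= nth_last.
have reach_live v : live v -> exists n, forall m, (n <= m)%N ->
    exists i, iter i f v \in S m /\ iter i f v \notin D.
  move=> [u [n [s [i [sS sD ilt ev eu]]]]].
  have [_ _ [lS lD] _ _] := gP sS sD; exists n.+1 => m /(reach _ _ m lS lD)[j].
  rewrite (_ : iter j f _ = iter (j + (size (g n s) - i))%N f v); first by exists (j + (size (g n s) - i))%N.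
  rewrite iterD; congr iter; rewrite ev -thread ?(ltnW ilt) // -iterD.
  by rewrite subnK ?(ltnW ilt) // (thread n) //= nth_last.
(* A predecessor of [x] lies on a path of a level [m] below [n], since [x] is not in the region of
   [S n]; the induction goes on from the start of that path. *)
have from_source n x : x \in S n -> x \notin D ->
    exists s i, source s /\ iter i f s = x.
  elim/ltn_ind: n x => n IH x xS xD.
  have [[v vx]|nx] := pselect (exists v, step v x); last first.
    by exists x, 0; split => //; split => //; exact: (live_start xS xD).
  case: (vx) => m [s [j [sS sD jlt ev eu]]].
  have mn : (m < n)%N.
    rewrite ltnNge; apply/negP => nm.
    have [_ [Sx _]] := step_level sS sD jlt; rewrite -eu in Sx.
    by move/negP: (region_notin (region_anti nm Sx)).
  have [s0 [i [ss0 si]]] := IH m mn s sS sD.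
  exists s0, (j.+1 + i)%N; split => //; by rewrite iterD si (thread m).
pose F : set (ray G) := [set Q | exists2 s, source s & forall i, Q i = iter i f s].
have F_ray s : source s -> exists2 Q, F Q & forall i, Q i = iter i f s.
  move=> ss; have inj : injective (fun i => iter i f s).
    by move=> i j /(source_inj _ _ _ _ ss ss)[].
  have ad i : adj G (iter i f s) (iter i.+1 f s).
    by apply/step_adj/fP/iter_live; case: ss.
  by exists (Ray inj ad) => //; exists s.
exists F; split.
(* For [n] so large that [X] misses [W n], the thread reaches [S n], and tightness gives a neighbour
   behind [S n], hence in the region of [X]. *)
- move=> Q [s [ls _] Qs]; apply: own_endI => X.
  have [n0 reachs] := reach_live s ls; have [n1 escX] := W_escape_fset X.
  pose n := maxn n0 n1; have [i [iS iD]] := reachs n (leq_maxl _ _); exists i.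
  have nWX v : v \in X -> ~ W n v.
    by move=> vX /(W_anti (leq_maxr n0 n1)); exact: escX.
  have [y Sy xy] := tightS iS iD.
  have /(_ y Sy) Xy : (region (S n) `<=` region X)%classic.
    apply: (@region_ind _ _ _ _ (region X)).
      have [k kX] := ray_escapes R X; exists k => m km; apply: region_ray => j mj.
      by apply: kX; exact: leq_trans mj.
    move=> u v _ Xu uv Sv; apply: region_step Xu uv _.
    by apply/negP => /nWX; apply; exact: regionW.
  rewrite Qs; apply: (region_step Xy); first by rewrite adj_sym.
  by apply/negP => /nWX; apply; split => //; left.
- move=> Q Q' [s ss Qs] [s' ss' Qs'] [v [[i _ iv] [j _ jv]]].
  have [_ e] := source_inj s s' i j ss ss' (etrans (esym (Qs i)) (etrans (etrans iv (esym jv)) (Qs' j))).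
  have QQ : (Q : nat -> V) = Q' by apply: funext => k; rewrite Qs Qs' e.
  case: Q Q' QQ {Qs Qs' iv jv} => [q qi qa] [q' qi' qa'] /= qq.
  by rewrite -{q'}qq in qi' qa' *; congr Ray; exact: Prop_irrelevance.
move=> finF n.
have /choice[h hP] x : exists Q : ray G, x \in S n `\` D -> F Q /\ exists i, Q i = x.
  have [|_] := boolP (x \in S n `\` D); last by exists R.
  rewrite inE => /andP[xD xS]; have [s [i [ss <-]]] := from_source n x xS xD.
  by have [Q FQ Qs] := F_ray s ss; exists Q => _; split => //; exists i.
have hI : {in S n `\` D &, injective h}.
  move=> x x' xS xS' hh; have [[s [ls _] Qs] [i ix]] := hP x xS.
  have [_ [j jx]] := hP x' xS'; rewrite -hh in jx.
  move: xS xS'; rewrite !inE => /andP[xD xS] /andP[xD' xS'].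
  rewrite !Qs in ix jx; clear Qs.
  wlog ij : i j x x' {hh} ix jx xD xS xD' xS' / (i < j)%N.
    move=> hw; have [ij|ij|ij] := ltngtP i j; first exact: (hw i j).
      exact/esym/(hw j i).
    by rewrite -ix -jx ij.
  exfalso; have lx : live x by rewrite -ix; exact: iter_live.
  have := @f_region n x (j - i)%N.-1 lx.
  rewrite prednK ?subn_gt0 // -{2}ix -iterD subnK ?(ltnW ij) // jx => rg.
  have /region_notin : region (S n) x' by apply: rg; split => //; left.
  by rewrite xS'.
have <- : #|` h @` (S n `\` D)| = #|` S n `\` D| by exact: card_in_imfset.
apply: fsubset_leq_card.
apply/fsubsetP => Q /imfsetP[x /= xS ->]; rewrite in_fset_set //.
by apply: mem_set; have [] := hP x xS.
Qed.
End Threads.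

(** [Zs n] collects the earlier cuts and the sets [Y i] up to [n], so its minimum cut also cuts
    [Y n] and inherits the lower bound. A sequence [Y] serves both cases: constant for one bound,
    varying for unbounded ones. *)
Lemma rays_of_cuts (V : choiceType) (G : graph V) (R : ray G) (D : {fset V})
    (Y : nat -> {fset V}) : (forall v, dominates v (own_end R) -> v \in D) ->
  exists F : set (ray G),
  [/\ (F `<=` own_end R)%classic, trivIset F (fun Q => range Q)
    & finite_set F -> forall n k,
      (forall S, cuts R D (Y n) S -> (k <= #|` S `\` D|)%N) ->
      (k <= #|` fset_set F|)%N].
Proof.
move=> domD.
have /choice[M MP] Z := @min_cut_exists V G R D Z (cuts_exists Z domD).
have [n0 n0D] := ray_escapes R D.
(* [R n0] is included so that the first cut satisfies [exitD]. *)
pose Zs := fix Zs n := if n is m.+1 then Zs m `|` M (Zs m) `|` Y n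
  else R n0 |` Y 0.
have ZsS n : Zs n.+1 = Zs n `|` M (Zs n) `|` Y n.+1 by [].
pose S n := M (Zs n).
have ZSY n : Y n `<=` Zs n.
  by case: n => [|n]; [exact: fsubsetUr|rewrite ZsS; exact: fsubsetUr].
have cutsS n : cuts R D (Zs n `|` S n) (S n.+1).
  by have [cS _ _] := MP (Zs n.+1); apply: cuts_sub cS; rewrite ZsS; exact: fsubsetUl.
have /choice[g gP] n := let: And3 cS _ mS := MP (Zs n) in
  let: And3 _ tS _ := MP (Zs n.+1) in min_cut_linkage cS mS (cutsS n) tS.
have [||||||F [Fw tF FS]] := @threads V G R D S g.
- by move=> n; have [[]] := MP (Zs n).
- by move=> n; have [] := MP (Zs n).
- by move=> n; apply: cuts_sub (cutsS n); exact: fsubsetUr.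
- by move=> n; exact: (proj1 (gP n)).
- by move=> n; exact: (proj2 (gP n)).
- exists n0; split => // /(proj2 (let: And3 c _ _ := MP (Zs 0) in c)) H.
  by move/negP: (n0D n0 (leqnn _)); apply; apply: H; rewrite !inE eqxx.
exists F; split => // fF n k kY; apply: leq_trans (FS fF n); apply: kY.
by apply: cuts_sub (ZSY n) _; have [] := MP (Zs n).
Qed.

Lemma lt_Fin i j : (Fin i < Fin j)%O = (i < j)%N.
Proof. by rewrite Order.TotalTheory.ltNge ltnNge. Qed.

(** * Closedness in the space of separations, in terms of rays, dominating vertices and cuts *)

Section SeparationSpace.
Context {V : choiceType} (G : graph V).
Implicit Types (s t : osep G) (Z : {fset V}) (T : set (osep G)).

Definition agree Z s t : Prop :=
  forall z, z \in Z -> (sideA s z <-> sideA t z) /\ (sideB s z <-> sideB t z).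

(** Agreeing with [s] on [Z] means lying in the basic open set given by the traces of [s] on [Z],
    and every basic open set around [s] arises so. *)
Lemma closed_agreeP T :
  closed T <-> forall s, ~ T s -> exists Z, forall t, agree Z s t -> ~ T t.
Proof.
split.
  move=> /closed_openC[I I_base eI] s nTs.
  have : (~` T)%classic s by []. 
  rewrite -eI => -[i Ii [/= iA iB]].
  have [finZ _] := I_base i Ii.
  exists (fset_set i.1) => t st; suff : (~` T)%classic t by [].
  have zP z : i.1 z -> (sideA s z <-> sideA t z) /\ (sideB s z <-> sideB t z).
    by move=> iz; apply: st; rewrite in_fset_set // mem_set.
  rewrite -eI; exists i => //; split; rewrite -?iA -?iB; apply/seteqP; split;
    by move=> z [zS iz]; have [[? ?] [? ?]] := zP z iz; split => //; auto.
move=> H; rewrite -(setCK T); apply: open_closedC.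
exists [set i | base_index G i /\ (@base_open V G i `<=` ~` T)%classic]%classic.
  by move=> i [].
apply/seteqP; split; first by move=> s [i [_ +] si]; exact.
move=> s /H[Z sZ]; exists (([set` Z], (sideA s `&` [set` Z], sideB s `&` [set` Z])))%classic;
  last by [].
split; first exact/restrP/finite_fset.
move=> t [/= tA tB]; apply: sZ => z zZ; split; split => zs.
- by have [] : (sideA t `&` [set` Z])%classic z by rewrite tA.
- by have [] : (sideA s `&` [set` Z])%classic z by rewrite -tA.
- by have [] : (sideB t `&` [set` Z])%classic z by rewrite tB.
- by have [] : (sideB s `&` [set` Z])%classic z by rewrite -tB.
Qed.

Definition sepr s : {fset V} := fset_set (sideA s `&` sideB s)%classic.

Lemma in_sepr s v : v \in sepr s <-> sideA s v /\ sideB s v.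
Proof.
rewrite in_fset_set; last exact: side_fin.
by split=> [/set_mem//|]; exact: mem_set.
Qed.

(** If [t] agrees with [s] on the separator of [s], the separator of [t] contains it. *)
Lemma order_locally_large k s : ~ osep_lt G k s ->
  exists Z, forall t, agree Z s t -> ~ osep_lt G k t.
Proof.
move=> nk; exists (sepr s) => t st kt; apply: nk; rewrite /osep_lt /= in kt *.
apply: Order.POrderTheory.le_lt_trans kt; rewrite /Order.le /=.
apply: fsubset_leq_card; apply/fsubsetP => v vs; apply/in_sepr.
by have [vA vB] := st v vs; move/in_sepr: vs => [/vA ? /vB ?].
Qed.

Lemma side_cover s v : sideA s v \/ sideB s v.
Proof. by have : (sideA s `|` sideB s)%classic v by rewrite (proj1 (sideP s)). Qed.

Lemma sideA_step s x y : sideA s x -> ~ sideB s x -> adj G x y ->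
  y \notin sepr s -> sideA s y /\ ~ sideB s y.
Proof.
move=> Ax Bx xy /negP ys; have [yA|yB] := side_cover s y.
  by split => // yB; apply: ys; apply/in_sepr.
have [yA|yA] := pselect (sideA s y); first by case: ys; exact/in_sepr.
by have := proj2 (sideP s) x y (conj Ax Bx) (conj yB yA); rewrite xy.
Qed.

Lemma sideB_step s x y : sideB s x -> ~ sideA s x -> adj G x y ->
  y \notin sepr s -> sideB s y /\ ~ sideA s y.
Proof.
move=> Bx Ax xy /negP ys; have [yA|yB] := side_cover s y; last first.
  by split => // yA; apply: ys; apply/in_sepr.
have [yB|yB] := pselect (sideB s y); first by case: ys; exact/in_sepr.
by have := proj2 (sideP s) y x (conj yA yB) (conj Bx Ax); rewrite adj_sym xy.
Qed.

Context (R : ray G).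
Local Notation w := (own_end R).
Local Notation tau := (end_tangle w).

(** The region lies strictly on one side; were it [sideB s], every ray of the end would have a tail
    there. *)
Lemma notin_tangle_region s v : ~ tau s -> region R (sepr s) v ->
  sideA s v /\ ~ sideB s v.
Proof.
move=> nts; have [n ns] := ray_escapes R (sepr s).
have [RA|RA] := pselect (sideA s (R n)); last first.
  exfalso; apply: nts => Q /(own_end_region (sepr s))[k kQ]; exists k => m /kQ Qm.
  suff [] : sideB s (Q m) /\ ~ sideA s (Q m) by [].
  have [/RA//|RB] := side_cover s (R n).
  apply: (linked_ind (P := fun x => sideB s x /\ ~ sideA s x)) (regionP Qm ns) => //.
  by move=> x y []; exact: sideB_step.
move=> Sv.
apply: (linked_ind (P := fun x => sideA s x /\ ~ sideB s x)) (regionP Sv ns) => //.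
  by split => // RB; move/negP: (ns n (leqnn n)); apply; apply/in_sepr.
by move=> x y []; exact: sideA_step.
Qed.

Lemma in_tangle_region s v : tau s -> region R (sepr s) v ->
  sideB s v /\ ~ sideA s v.
Proof.
move=> ts; have [n ns] := ray_escapes R (sepr s).
have [k kB] := ts R (@own_end_self _ _ R).
have mS m : (maxn n k <= m)%N -> R m \notin sepr s.
  by rewrite geq_max => /andP[/ns].
have RB := kB _ (leq_maxr n k) => Sv.
apply: (linked_ind (P := fun x => sideB s x /\ ~ sideA s x)) (regionP Sv mS) => //.
  by split => // RA; move/negP: (mS _ (leqnn _)); apply; apply/in_sepr.
by move=> x y []; exact: sideB_step.
Qed.

Lemma dominates_sideB s d : tau s -> dominates d w -> sideB s d.
Proof.
move=> ts dd; have [/in_sepr[]//|dS] := boolP (d \in sepr s).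
by have [] := in_tangle_region ts (dominates_region dd dS).
Qed.

Lemma dominates_sideA s d : ~ tau s -> dominates d w -> sideA s d.
Proof.
move=> ts dd; have [/in_sepr[]//|dS] := boolP (d \in sepr s).
by have [] := notin_tangle_region ts (dominates_region dd dS).
Qed.

Lemma closed_tangle_lt k :
  (forall s, ~ tau s -> osep_lt G k s -> exists Z, forall t, agree Z s t ->
    tau t -> osep_lt G k t -> False) ->
  closed (tau `&` osep_lt G k)%classic.
Proof.
move=> H; apply/closed_agreeP => s ns.
have [ks|/order_locally_large[Z sZ]] := pselect (osep_lt G k s); last first.
  by exists Z => t /sZ nt [].
have nts : ~ tau s by move=> ts; apply: ns.
by have [Z sZ] := H s nts ks; exists Z => t st [tt kt]; exact: sZ st tt kt.
Qed.

(** Some dominating [d] avoids the separator of [s]. It is in [sideA s], and agreement at [d] with a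
    member of the tangle would put it in [sideB s] too. *)
Lemma closed_infinite_dom k : infinite_set [set v | dominates v w]%classic ->
  closed (tau `&` osep_lt G k)%classic.
Proof.
move=> inf; apply: closed_tangle_lt => s nts _.
have [d [dd nd]] := infinite_setN0 (infinite_setD inf (finite_fset (sepr s))).
exists [fset d] => t st tt _.
have [_ dB] := st d (fset11 d).
apply: nd; apply/in_sepr; split; first exact: dominates_sideA.
by apply/dB; exact: dominates_sideB.
Qed.

(** Let [t] in the tangle agree with [s] on [D] and on one late vertex of each ray in [F]. Each ray
    then passes from strictly inside [sideA t] to [sideB t] through the separator of [t], which also
    contains [D]; so its order is at least [k]. *)
Lemma closed_rays_dom (F : {fset ray G}) (D : {fset V}) k :
  {subset F <= w} -> trivIset [set` F] (fun Q => range Q) ->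
  (forall d, d \in D -> dominates d w) ->
  (k <= #|` F| + #|` D|)%N -> closed (tau `&` osep_lt G (Fin k))%classic.
Proof.
move=> Fw tF domD kFD; apply: closed_tangle_lt => s nts _.
(* The chosen tails also avoid [D], lest a crossing vertex be counted twice. *)
have /choice[n nP] (Q : ray G) : exists n, Q \in F -> forall m, (n <= m)%N ->
    region R (sepr s) (Q m) /\ Q m \notin D.
  have [QF|] := boolP (Q \in F); last by exists 0.
  have [i iP] := own_end_region (sepr s) (set_mem (Fw Q QF)).
  have [j jP] := ray_escapes Q D; exists (maxn i j) => _ m.
  by rewrite geq_max => /andP[/iP ? /jP].
exists (D `|` [fset (Q : ray G) (n Q) | Q in F]) => t st tt kt.
have /choice[y yP] (Q : ray G) : exists v, Q \in F ->
    [/\ v \in sepr t, v \notin D & range Q v].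
  have [QF|] := boolP (Q \in F); last by exists (Q 0).
  apply: contrapT => nex.
  have nQ m : (n Q <= m)%N -> Q m \notin sepr t.
    move=> nm; apply/negP => Qt; apply: nex; exists (Q m) => _; split => //.
      by have [] := nP Q QF m nm.
  have QA m : (n Q <= m)%N -> sideA t (Q m) /\ ~ sideB t (Q m).
    move=> /subnK <-; elim: (m - n Q)%N => [|i [IA IB]].
      have [rQ _] := nP Q QF _ (leqnn (n Q)).
      have [AQ BQ] := notin_tangle_region nts rQ.
      have [|? ?] := st (Q (n Q)); last by rewrite add0n; tauto.
      by rewrite inE; apply/orP; right; apply/imfsetP; exists Q.
    by apply: sideA_step IA IB (ray_adj Q _) _; apply: nQ; exact/leqW/leq_addl.
  have [j jB] := tt Q (set_mem (Fw Q QF)).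
  have [_] := QA _ (leq_maxl (n Q) j); apply; apply: jB; exact: leq_maxr.
have : (#|` sepr t| < k)%N by rewrite -lt_Fin.
apply/negP; rewrite -leqNgt; apply: leq_trans kFD _.
have yI : {in F &, injective y}.
  move=> Q Q' QF QF' e; apply: tF => //; exists (y Q); split.
    by have [] := yP Q QF.
  by rewrite e; have [] := yP Q' QF'.
have <- : #|` y @` F| = #|` F| by exact: card_in_imfset.
have dis : [disjoint y @` F & D]%fset.
  apply/fdisjointP => v /imfsetP[Q /= QF ->]; by have [] := yP Q QF.
rewrite -cardfsUI (eqP (dis : y @` F `&` D == fset0)) cardfs0 addn0.
apply: fsubset_leq_card; rewrite fsubUset; apply/andP; split; apply/fsubsetP => v.
  by move=> /imfsetP[Q /= QF ->]; have [] := yP Q QF.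
move=> vD; apply/in_sepr; split; last exact/dominates_sideB/domD.
have [|[vA _] _] := st v; first by rewrite inE vD.
by apply: vA; exact/dominates_sideA/domD.
Qed.

(** Used with [C] empty for the separation (V, S), and with [C] the region of [S] for the one that
    points to the end. *)
Lemma separation_around (S : {fset V}) (C : set V) : 
  (forall x, x \in S -> ~ C x) -> (forall x y, C x -> adj G x y -> y \notin S -> C y) ->
  exists s : osep G, [/\ forall v, sideA s v <-> ~ C v,
     forall v, sideB s v <-> v \in S \/ C v & sepr s = S].
Proof.
move=> SC CS.
have sp : is_separation G setT (~` C)%classic ([set` S] `|` C)%classic.
  split.
    apply/seteqP; split => // v _.
    by have [|] := pselect (C v); [right; right|left].
  move=> x y [nCx nB] [[yS|Cy] nA].
    by exfalso; apply: nA; exact: SC.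
  have xS : x \notin S by apply/negP => xS; apply: nB; left.
  apply/negP => xy; apply: nCx; apply: CS Cy _ xS; by rewrite adj_sym.
have e : (~` C `&` ([set` S] `|` C) = [set` S])%classic.
  apply/seteqP; split => [v [nC [//|//]]|v vS]; by split; [exact: SC|left].
have fi : finite_set (~` C `&` ([set` S] `|` C))%classic.
  by rewrite e; exact: finite_fset.
exists (OSep sp fi); split => //; apply/fsetP => v.
by apply/idP/idP => [/in_sepr[/= nC []//]|vS]; apply/in_sepr; split;
  [exact: SC|left].
Qed.

(** [Z] witnesses that (V, D) is not a limit of the closed set. For a cut [S] of [Z] the separation
    around [S] with the region on its second side is in the tangle and agrees with (V, D) on [Z], so
    its order is not below [k]. *)
Lemma closed_cuts (D : {fset V}) k :
  (forall v, v \in D <-> dominates v w) -> closed (tau `&` osep_lt G k)%classic ->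
  exists Z, forall S, cuts R D Z S -> ~ (Fin #|` S| < k)%O.
Proof.
move=> domD cl.
have [s [sA sB sD]] := @separation_around D set0 (fun _ _ => id) (fun _ _ H _ _ => H).
have [|Z sZ] := (proj1 (closed_agreeP _) cl) s.
  move=> [ts _]; have [n nB] := ts R (@own_end_self _ _ R).
  have [m mD] := ray_escapes R D.
  have /sB[RD|//] := nB _ (leq_maxl n m).
  by move/negP: (mD _ (leq_maxr n m)).
exists Z => S [DS cS] ltS.
have [||t [tA tB tS]] := @separation_around S (region R S).
- by move=> x xS /region_notin; rewrite xS.
- by move=> x y; exact: region_step.
apply: (sZ t).
  move=> z zZ; have [As As'] := sA z; have [At At'] := tA z.
  have [Bs Bs'] := sB z; have [Bt Bt'] := tB z.
  have zD : z \in S \/ region R S z -> z \in D by exact: cS.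
  have DzS : z \in D -> z \in S by exact: (fsubsetP DS).
  have nzS : region R S z -> z \notin S by exact: region_notin.
  split; split => zs.
  - by apply: At' => rz; move/negP: (nzS rz); apply; apply/DzS/zD; right.
  - exact: As'.
  - by apply: Bt'; left; case: (Bs zs) => // /DzS.
  - by apply: Bs'; left; apply: zD; exact: Bt.
split; last by rewrite /osep_lt /= /order_of -/(sepr t) tS.
move=> Q /(own_end_region S)[n nQ]; exists n => m /nQ Qm.
by apply/tB; right.
Qed.
End SeparationSpace.

Lemma supremum_max d (T : porderType d) (x0 x : T) (A : set T) :
  A x -> ubound A x -> supremum x0 A = x.
Proof.
move=> Ax ubx; rewrite /supremum ifF; last by apply/negbTE/set0P; exists x.
apply: xget_subset1; last exact: is_subset1_supremums.
by split => // y /(_ x Ax).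
Qed.

Lemma size_of_finite (T : choiceType) (A : set T) :
  finite_set A -> size_of A = ENat #|` fset_set A|.
Proof. by move=> fA; rewrite /size_of; case: pselect. Qed.

Lemma size_of_infinite (T : choiceType) (A : set T) :
  infinite_set A -> size_of A = EInf.
Proof. by move=> iA; rewrite /size_of; case: pselect. Qed.

(** * Computing cohesion from degree and domination *)

Section Cohesion.
Context {V : choiceType} (G : graph V).
Implicit Types (F : set (ray G)).

Lemma deg_max (w : set (ray G)) F : (F `<=` w)%classic ->
  trivIset F (fun Q => range Q) ->
  (forall F', (F' `<=` w)%classic -> trivIset F' (fun Q => range Q) ->
     (size_of F' <= size_of F)%O) -> deg w = size_of F.
Proof.
move=> Fw tF maxF; apply: xget_subset1.
  split; first by exists F.
  by move=> _ [F' [Fw' tF'] <-]; exact: maxF.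
move=> x y [Ax ux] [Ay uy]; apply/Order.POrderTheory.le_anti.
by rewrite uy // ux.
Qed.

Context (R : ray G).
Local Notation w := (own_end R).
Local Notation closed_lt k := (closed (end_tangle w `&` osep_lt G k)%classic).

Lemma coh_dom_infinite : infinite_set [set v | dominates v w]%classic ->
  coh w = Aleph1.
Proof.
move=> inf; apply: supremum_max; first by move=> k _; exact: closed_infinite_dom.
by case.
Qed.

Lemma closed_finite_rays (D : {fset V}) F k :
  (forall v, v \in D <-> dominates v w) -> (F `<=` w)%classic ->
  trivIset F (fun Q => range Q) -> (ENat k <= enat_add (size_of F) (ENat #|` D|))%O ->
  closed_lt (Fin k).
Proof.
move=> domD Fw tF kF.
have [B BF kB] : exists2 B : {fset ray G}, ([set` B] `<=` F)%classic &
    (k <= #|` B| + #|` D|)%N.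
  have [fF|/(infinite_set_fset k)[B BF kB]] := pselect (finite_set F); last first.
    by exists B => //; apply: leq_trans kB (leq_addr _ _).
  exists (fset_set F); first by rewrite fset_setK.
  by move: kF; rewrite size_of_finite.
apply: (closed_rays_dom _ _ _ kB); last by move=> d /domD.
- by move=> Q QB; apply/mem_set/Fw/BF.
- exact: sub_trivIset tF.
Qed.

(** If all finite parts are closed, the cuts have unbounded size and yield infinitely many rays.
    Otherwise let [j.+1] be the first part that is not closed: closedness at [j] gives a family of
    at least [j - |D|] rays, and failure at [j.+1] forbids more. *)
Lemma coh_dom_finite (D : {fset V}) : (forall v, v \in D <-> dominates v w) ->
  (coh w = Aleph0 /\ deg w = EInf) \/
  exists m, coh w = Fin (m + #|` D|).+1 /\ deg w = ENat m.
Proof.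
move=> domD; have domD' v : dominates v w -> v \in D by move/domD.
(* Every finite size is below [Aleph0], so some [Z] would have no cut at all. *)
have not_closed : ~ closed_lt Aleph0.
  move=> /(closed_cuts domD)[Z Zlt]; have [S cS] := cuts_exists Z domD'.
  exact: Zlt cS _.
have cardD k (S : {fset V}) : D `<=` S -> (k <= #|` S|)%N ->
    (k - #|` D| <= #|` S `\` D|)%N.
  by move=> DS kS; rewrite cardfsD (fsetIidPr DS) leq_sub2r.
have cut_size k : closed_lt (Fin k) -> exists Z, forall S, cuts R D Z S ->
    (k - #|` D| <= #|` S `\` D|)%N.
  move=> /(closed_cuts domD)[Z Zlt]; exists Z => S cS; have [DS _] := cS.
  by apply: cardD => //; rewrite leqNgt -lt_Fin; apply/negP; exact: Zlt.
have [allC|/existsNP nC] := pselect (forall k, closed_lt (Fin k)).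
  left; split.
    apply: supremum_max; first by case.
    by case=> // /(_ Aleph0 isT).
  have /choice[Y YP] k := cut_size k (allC k).
  have [F [Fw tF FY]] := rays_of_cuts Y domD'.
  have infF : infinite_set F.
    (* The index makes the bound read |F| + 1 <= |F|. *)
    move=> fF; have := FY fF _ _ (YP (#|` fset_set F| + #|` D|).+1).
    by rewrite subSn ?leq_addl // addnK ltnn.
  rewrite -(size_of_infinite infF); apply: deg_max => // F' _ _.
  by rewrite (size_of_infinite infF); case: size_of.
have exk : exists k, `[< ~ closed_lt (Fin k) >].
  by have [k nk] := nC; exists k; apply/asboolP.
(* Part 0 is closed by the empty family, so the first failing index is a successor. *)
case: (ex_minnP exk) => -[|j] /asboolP njC minj.
  exfalso; apply: njC; apply: (closed_finite_rays domD (sub0set _)).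
    by move=> Q Q' [].
  by case: size_of.
have ltC k : (k < j.+1)%N -> closed_lt (Fin k).
  move=> kj; apply: contrapT => nk; move: kj.
  by rewrite ltnNge; move/negP; apply; apply: minj; exact/asboolP.
have [Z ZP] := cut_size j (ltC j (ltnSn j)).
have [F [Fw tF FY]] := rays_of_cuts (fun=> Z) domD'.
have upper F' : (F' `<=` w)%classic -> trivIset F' (fun Q => range Q) ->
    exists m, size_of F' = ENat m /\ (m + #|` D| <= j)%N.
  move=> Fw' tF'; have := contra_not (closed_finite_rays (k := j.+1) domD Fw' tF') njC.
  case: size_of => [m|] /= H; last by exfalso; exact: H.
  by exists m; split => //; rewrite leqNgt; apply/negP.
have [m [Fm mj]] := upper F Fw tF.
have fF : finite_set F.
  by apply: contrapT => /size_of_infinite; rewrite Fm.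
have jm : (j <= m + #|` D|)%N.
  have := FY fF 0 _ ZP; move: Fm; rewrite size_of_finite // => -[->].
  by rewrite leq_subLR addnC.
have {mj jm} ej : j = (m + #|` D|)%N by apply/eqP; rewrite eqn_leq jm mj.
right; exists m; split.
  rewrite -ej; apply: supremum_max; first by case=> // k; rewrite lt_Fin; exact: ltC.
  move=> k Ck; rewrite Order.TotalTheory.leNgt; apply/negP => /Ck; exact: njC.
rewrite -Fm; apply: deg_max => // F' Fw' tF'.
have [m' [-> mj']] := upper F' Fw' tF'.
by rewrite Fm; move: mj'; rewrite ej leq_add2r.
Qed.
End Cohesion.

Theorem theorem4p4 (V : choiceType) (G : graph V) (w : set (ray G))
    (hV : infinite_set [set: V]) (hw : is_end w) :
  [/\ (coh w = Aleph1 <-> dom w = EInf),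
      (coh w = Aleph0 <-> deg w = EInf /\ (dom w < EInf)%O)
    & forall k : nat, coh w = Fin k <->
        (0 < k)%N /\ enat_add (deg w) (dom w) = ENat k.-1].
Proof.
case: hw => R ->; rewrite -/(own_end R).
have [fD|iD] := pselect (finite_set [set v | dominates v (own_end R)]); last first.
  rewrite /dom (size_of_infinite iD) (coh_dom_infinite iD).
  by split; [split|split => // -[]|move=> k; split => // -[_]; case: deg].
rewrite /dom (size_of_finite fD); set D := fset_set _.
have domD v : v \in D <-> dominates v (own_end R).
  by rewrite in_fset_set //; split => [/set_mem|/mem_set].
have [[-> ->]|[m [-> ->]]] := coh_dom_finite domD.
  by split; [split|split|move=> k; split => // -[]].
split; [split|split => // -[]|move=> k] => //=.
split => [[<-]//|[k0 [->]]]; by rewrite prednK.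
Qed.
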